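(* Let $H$ be a $p$-variate cumulative distribution function with continuous margins $F_1,\ldots,F_p$ and copula $C$, and suppose that for every $j\in\{1,\ldots,p\}$ the first-order partial derivative $\dot C_j(\mathbf u)=\partial C(\mathbf u)/\partial u_j$ exists and is continuous on the set $\{\mathbf u\in[0,1]^p: 0<u_j<1\}$. Let $\hat H_n$ be random $p$-variate cumulative distribution functions and $\hat F_{n,1},\ldots,\hat F_{n,p}$ random univariate cumulative distribution functions (estimators of $H$ and $F_1,\ldots,F_p$; $\hat F_{n,j}$ need not be the $j$th margin of $\hat H_n$), and define the hybrid copula estimator \[\hat C_n(\mathbf u)=\hat H_n\bigl(\hat F_{n,1}^\leftarrow(u_1),\ldots,\hat F_{n,p}^\leftarrow(u_p)\bigr),\qquad \mathbf u\in[0,1]^p.\] Assume there exists $0<r_n\to\infty$ such that, in the product space $\ell^\infty(\mathbb R^p)\times\ell^\infty(\mathbb R)\times\cdots\times\ell^\infty(\mathbb R)$ ($p$ copies of $\ell^\infty(\mathbb R)$) equipped with the topology of uniform convergence, we have joint weak convergence \[\bigl(r_n(\hat H_n-H);\,r_n(\hat F_{n,1}-F_1),\ldots,r_n(\hat F_{n,p}-F_p)\bigr)\rightsquigarrow(\alpha\circ\mathbf F;\,\beta_1\circ F_1,\ldots,\beta_p\circ F_p),\qquad n\to\infty,\] where $\alpha$ is a random element of $\ell^\infty([0,1]^p)$ and $\beta_j$ are random elements of $\ell^\infty([0,1])$ such that $\alpha\circ\mathbf F$ and $\beta_j\circ F_j$ have continuous trajectories on $[-\infty,\infty]^p$ and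 $[-\infty,\infty]$, respectively, almost surely. Then, uniformly in $\mathbf u\in[0,1]^p$, as $n\to\infty$, \[r_n\{\hat C_n(\mathbf u)-C(\mathbf u)\}=r_n\{\hat H_n(\mathbf F^\leftarrow(\mathbf u))-C(\mathbf u)\}-\sum_{j=1}^p\dot C_j(\mathbf u)\,r_n\{\hat F_{n,j}(F_j^\leftarrow(u_j))-u_j\}\,\mathbb 1_{(0,1)}(u_j)+o_p(1).\] Hence, in $\ell^\infty([0,1]^p)$ with the supremum norm, as $n\to\infty$, \[\bigl(r_n\{\hat C_n(\mathbf u)-C(\mathbf u)\}\bigr)_{\mathbf u\in[0,1]^p}\rightsquigarrow\Bigl(\alpha(\mathbf u)-\sum_{j=1}^p\dot C_j(\mathbf u)\,\beta_j(u_j)\Bigr)_{\mathbf u\in[0,1]^p}.\] Moreover, the processes $\alpha$ and $\beta_j$ have continuous trajectories almost surely, and $\beta_j(0)=\beta_j(1)=0$ almost surely (so the right-hand side of the limit is well-defined).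
   Context: For a univariate cumulative distribution function $G$, $G^\leftarrow(u)=\inf\{x\in\mathbb R: G(x)\ge u\}$ for $u\in[0,1]$, with conventions $\inf\varnothing=+\infty$, $G(-\infty)=0$, $G(+\infty)=1$. Write $\mathbf F(\mathbf x)=(F_1(x_1),\ldots,F_p(x_p))$ and $\mathbf F^\leftarrow(\mathbf u)=(F_1^\leftarrow(u_1),\ldots,F_p^\leftarrow(u_p))$. The copula $C$ satisfies $H(\mathbf x)=C(\mathbf F(\mathbf x))$ and $C(\mathbf u)=H(\mathbf F^\leftarrow(\mathbf u))$. $\ell^\infty(T)$ is the space of bounded real functions on $T$ with the supremum norm. $\rightsquigarrow$ denotes weak convergence in the sense of Hoffmann-Jørgensen, and $o_p(1)$ refers to remainder terms converging to zero in outer probability uniformly in $\mathbf u$. $\mathbb 1_{(0,1)}$ is the indicator of $(0,1)$. *)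

(* Defs.v *)
From mathcomp Require Import all_boot all_order all_algebra.
From mathcomp Require Import all_classical all_reals all_analysis.
From mathcomp Require Import measurable_realfun.
Import Order.TTheory GRing.Theory Num.Theory numFieldNormedType.Exports.
Local Open Scope ring_scope.
Local Open Scope classical_set_scope.

Section Defs.
Context {R : realType}.

Definition supdist {T : Type} (A : set T) (f g : T -> R) : \bar R :=
  ereal_sup [set (`|f t - g t|)%:E | t in A].

(* f is bounded on A, i.e. (the restriction of) f is an element of l^oo(A) *)
Definition bnd {T : Type} (A : set T) (f : T -> R) : Prop :=
  exists M : R, forall t, A t -> `|f t| <= M.

Definition metric_open {D : Type} (inS : D -> Prop) (dist : D -> D -> \bar R)
  (U : set D) : Prop :=
  U `<=` inS /\
  forall f, U f -> exists2 e : R, 0 < e &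
    forall g, inS g -> (dist f g < e%:E)%E -> U g.

Definition bcont {D : Type} (inS : D -> Prop) (dist : D -> D -> \bar R)
  (h : D -> R) : Prop :=
  (exists M : R, forall f, `|h f| <= M) /\
  forall f, inS f -> forall e : R, 0 < e -> exists2 dl : R, 0 < dl &
    forall g, inS g -> (dist f g < dl%:E)%E -> `|h f - h g| < e.

Definition outer_prob {d} {T : measurableType d} (P : probability T R)
  (A : set T) : \bar R :=
  ereal_inf [set P B | B in [set B | measurable B /\ A `<=` B]].

Definition outer_expect {d} {T : measurableType d} (P : probability T R)
  (f : T -> R) : \bar R :=
  ereal_inf [set (\int[P]_x U x)%E | U in
     [set U : T -> \bar R | measurable_fun setT U /\ forall x, ((f x)%:E <= U x)%E]].

(* X is a random element of the metric space: a.s. valued in the space and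
   Borel measurable (with respect to the completion of P). *)
Definition random_elt {d} {T : measurableType d} (P : probability T R)
  {D : Type} (inS : D -> Prop) (dist : D -> D -> \bar R) (X : T -> D) : Prop :=
  {ae P, forall w, inS (X w)} /\
  forall U, metric_open inS dist U ->
    exists A N : set T, [/\ measurable A, measurable N, P N = 0%E &
      ((X @^-1` U) `\` A) `|` (A `\` (X @^-1` U)) `<=` N].

(* Weak convergence in the sense of Hoffmann-Jorgensen:
   X_n (arbitrary maps on (Om n, P n)) converges weakly to the random element Y
   iff E^* h(X_n) -> E h(Y) for every bounded continuous h. *)
Definition weak_conv {D : Type} (inS : D -> Prop) (dist : D -> D -> \bar R)
  {d} {Om : nat -> measurableType d} (P : forall n, probability (Om n) R)
  (X : forall n, Om n -> D)
  {d0} {Om0 : measurableType d0} (P0 : probability Om0 R) (Y : Om0 -> D) : Prop :=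
  random_elt P0 inS dist Y /\
  forall h, bcont inS dist h ->
    (fun n => outer_expect (P n) (h \o X n)) @ \oo --> outer_expect P0 (h \o Y).

Definition prod_inS (p : nat) (fg : ('rV[R]_p -> R) * ('I_p -> R -> R)) : Prop :=
  bnd setT fg.1 /\ forall j, bnd setT (fg.2 j).

Definition prod_dist (p : nat) (fg fg' : ('rV[R]_p -> R) * ('I_p -> R -> R)) : \bar R :=
  maxe (supdist setT fg.1 fg'.1)
       (\big[maxe/0%E]_(j < p) supdist setT (fg.2 j) (fg'.2 j)).

(* R^p (row vectors) with the sigma-algebra generated by lower orthants
   (= the Borel sigma-algebra) *)
Definition orthants (p : nat) : set (set 'rV[R]_p) :=
  [set [set y : 'rV[R]_p | forall i, y ord0 i <= x ord0 i] | x in [set: 'rV[R]_p]].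
Definition Rp (p : nat) := g_sigma_algebraType (orthants p).

Definition cdf1 (mu : probability R R) (x : R) : R := fine (mu `]-oo, x]).
Definition cdf1e (mu : probability R R) (y : \bar R) : R :=
  fine (mu [set x : R | (x%:E <= y)%E]).

(* generalized inverse G^<-(u) = inf {x in R : G(x) >= u}, inf set0 = +oo *)
Definition qf (mu : probability R R) (u : R) : \bar R :=
  ereal_inf [set x%:E | x in [set x : R | u <= cdf1 mu x]].

Definition cdfp {p : nat} (mu : probability (Rp p) R) (x : 'rV[R]_p) : R :=
  fine (mu [set y : Rp p | forall i, (y : 'rV[R]_p) ord0 i <= x ord0 i]).
Definition cdfpe {p : nat} (mu : probability (Rp p) R) (y : 'rV[\bar R]_p) : R :=
  fine (mu [set z : Rp p | forall i, (((z : 'rV[R]_p) ord0 i)%:E <= y ord0 i)%E]).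

Definition hybrid_copula {p : nat} (muH : probability (Rp p) R)
  (muF : 'I_p -> probability R R) (u : 'rV[R]_p) : R :=
  cdfpe muH (\row_i qf (muF i) (u ord0 i)).

Definition cube (p : nat) : set 'rV[R]_p :=
  [set u | forall i, 0 <= u ord0 i <= 1].
Definition Sj {p : nat} (j : 'I_p) : set 'rV[R]_p :=
  [set u | cube p u /\ 0 < u ord0 j < 1].
Definition ind01 (x : R) : R := if (0 < x < 1) then 1 else 0.

End Defs.

(* Main.v *)
From HB Require Import structures.
Require Import Defs.
From mathcomp Require Import all_boot all_order all_algebra.
From mathcomp Require Import all_classical all_reals all_analysis.
From mathcomp Require Import measurable_realfun.
From mathcomp Require Import ring lra.
Import Order.TTheory GRing.Theory Num.Theory numFieldNormedType.Exports.
Local Open Scope ring_scope.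
Local Open Scope classical_set_scope.

(** Write X_n for the pair of estimation processes and X for its limit. For
    almost every outcome of the limit, alpha and beta_j are uniformly continuous
    on the cube, since cdf's map the compact space of extended reals onto [0, 1],
    and beta_j vanishes at 0 and 1, since every X_n does at infinity and almost
    every value of X is approximated by values of the X_n. For such an outcome a
    deterministic argument applies as soon as X_n is uniformly close to X: if y
    is the vector of empirical quantiles of u and v = F(y), then
    r_n (v_j - u_j) is close to - beta_j (v_j), the mean value theorem, one
    coordinate at a time, turns r_n (C v - C u) into - sum_j C'_j(u) beta_j(u_j),
    and both sides of the expansion are close to the limit process at X.
    This is transferred to weak convergence by an extended continuous mapping
    theorem, in which functionals of the X_n with n >= k are dominated by one
    Lipschitz functional decreasing, as k grows, to the functional of X. *)

(** The main obstacle is the behaviour at the faces of the cube: the partial derivative C'_j is only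
    controlled where 0 < u_j < 1, so it has no modulus of continuity near the two faces u_j = 0 and
    u_j = 1. The expansion survives because C is 1-Lipschitz in each coordinate, hence |C'_j| <= 1,
    while beta_j vanishes on these faces. The product C'_j beta_j is then uniformly continuous on
    the whole cube, and in the estimates a derivative at a mean value point is always kept together
    with a value of beta_j. A second obstacle is that the X_n are arbitrary maps, to which only
    outer expectations apply. Only upper bounds are proved for these, and lower bounds come from the
    opposite functional. Closeness to the limit is required near almost every value of the limit
    only, which is where continuity of the trajectories is known. *)

(** * Outer expectations and outer probabilities *)

Section outer_expectation.
Context {R : realType} {d : measure_display} {T : measurableType d}.
Context (P : probability T R).

(** Signed functions are compared through their positive parts, ordered alike, and their negative
    parts, ordered the opposite way. *)
Lemma ae_le_integral (f g : T -> \bar R) :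
  measurable_fun setT f -> measurable_fun setT g ->
  {ae P, forall x, (f x <= g x)%E} -> (\int[P]_x f x <= \int[P]_x g x)%E.
Proof.
move=> mf mg fg; rewrite integralE [leRHS]integralE; apply: leeB.
  apply: ae_ge0_le_integral => //.
  - exact: measurable_funepos.
  - exact: measurable_funepos.
  - apply: filterS fg => x fgx _; rewrite !funeposE.
    by rewrite ge_max !le_max fgx lexx orbT.
apply: ae_ge0_le_integral => //.
- exact: measurable_funeneg.
- exact: measurable_funeneg.
- apply: filterS fg => x fgx _; rewrite !funenegE.
  by rewrite ge_max !le_max leeN2 fgx lexx orbT.
Qed.

Lemma outer_expect_ae (f g : T -> R) : measurable_fun setT g ->
  {ae P, forall x, f x = g x} -> outer_expect P f = (\int[P]_x (g x)%:E)%E.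
Proof.
move=> mg fg; have mEg : measurable_fun setT (EFin \o g) by exact/measurable_EFinP.
apply/eqP; rewrite eq_le; apply/andP; split; last first.
  apply: le_ereal_inf_tmp => _ [U [mU fU] <-].
  apply: ae_le_integral => //.
  by apply: filterS fg => x <-.
have [N [mN PN fgN]] := fg.
(* [f] is arbitrary on the null set [N] and a majorant must hold everywhere, hence the value +oo
   there. *)
pose U := fun x => if x \in N then +oo%E else (g x)%:E.
have mU : measurable_fun setT U.
  apply: measurable_fun_ifT => //.
  apply: (measurable_fun_bool true); rewrite setTI.
  rewrite (_ : _ @^-1` _ = N) //.
  by apply/seteqP; split=> x /=; [move/set_mem|move/mem_set].
have <- : (\int[P]_x U x = \int[P]_x (g x)%:E)%E.
  apply: ae_eq_integral => //.
  exists N; split => // x /= /not_implyP [_] Ux; apply: contrapT => Nx; apply: Ux.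
  by rewrite /U memNset.
apply: ereal_inf_lbound; exists U => //; split => // x; rewrite /U.
case: ifPn => [_|]; first by rewrite leey.
rewrite notin_setE => Nx; rewrite lee_fin.
by have -> : f x = g x by apply: contrapT => fgx; apply: Nx; exact: fgN.
Qed.

Lemma le_outer_expect (f g : T -> R) :
  (forall x, f x <= g x) -> (outer_expect P f <= outer_expect P g)%E.
Proof.
move=> fg; apply: le_ereal_inf_tmp => _ [U [mU gU] <-].
apply: ereal_inf_lbound; exists U => //; split=> // x.
by apply: le_trans (gU x); rewrite lee_fin.
Qed.

(** This converts an upper bound for - f into a lower bound for [f]. Majorants [U] of [f] and [V] of
    - f satisfy - V <= f <= U. *)
Lemma outer_expectN_le (f : T -> R) (m : R) : (forall x, `|f x| <= m) ->
  (- outer_expect P (fun x => - f x)%R <= outer_expect P f)%E.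
Proof.
move=> fm; apply: le_ereal_inf_tmp => _ [U [mU fU] <-]; rewrite leeNl.
apply: le_ereal_inf_tmp => _ [V [mV fV] <-].
(* Moving the sign through the integral of [V] must avoid oo - oo: since V >= - f >= - m, its
   negative part is at most [m]. *)
rewrite leeNl -integralN/=; last first.
  apply: fin_num_adde_defl; rewrite fin_numN ge0_fin_numE; last first.
    exact: integral_ge0.
  apply: (@le_lt_trans _ _ (\int[P]_x (cst m%:E x))%E); last first.
    by rewrite integral_cst// ltey_eq fin_numM// fin_num_measure.
  apply: ae_le_integral => //; first exact: measurable_funeneg.
  apply: aeW => x; rewrite funenegE ge_max leeNl; apply/andP; split.
    apply: le_trans (fV x); rewrite -EFinN lee_fin lerN2.
    exact: le_trans (ler_norm _) (fm x).
  by rewrite lee_fin (le_trans _ (fm x)).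
apply: ae_le_integral => //; first exact: measurableT_comp.
apply: aeW => x; apply: le_trans (fU x).
by rewrite leeNl -EFinN.
Qed.

(** Markov's inequality for any measurable majorant [U] of the indicator: the event 1 <= U is a
    measurable cover of [A]. *)
Lemma outer_prob_le_expect (A : set T) :
  (outer_prob P A <= outer_expect P \1_A)%E.
Proof.
apply: le_ereal_inf_tmp => _ [U [mU AU] <-].
have mB : measurable [set x | (1 <= U x)%E].
  have := emeasurable_fun_c_infty measurableT mU 1%E.
  by rewrite setTI.
apply: (@le_trans _ _ (P [set x | (1 <= U x)%E])).
  apply: ereal_inf_lbound; exists [set x | (1 <= U x)%E] => //; split => // x Ax.
  by have := AU x; rewrite indicE mem_set.
rewrite -[X in (P X <= _)%E]setIT -integral_indic//.
apply: ae_le_integral => //.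
  by apply/measurable_EFinP; exact: measurable_indic.
apply: aeW => x; rewrite indicE; case: (boolP (_ \in _)); first by rewrite inE.
by move=> _; apply: le_trans (AU x); rewrite lee_fin.
Qed.

Lemma outer_prob_ge0 (A : set T) : (0 <= outer_prob P A)%E.
Proof. by apply: le_ereal_inf_tmp => _ [B [mB _] <-]. Qed.

(* The composition of a random element with a bounded continuous function is
   measurable only for the completion of P, hence the almost sure version g. *)
Lemma bcont_random_elt_measurable (D : Type) (inS : D -> Prop)
    (dist : D -> D -> \bar R) (X : T -> D) (h : D -> R) (m : R) :
  random_elt P inS dist X -> bcont inS dist h -> (forall x, `|h x| <= m) ->
  exists g : T -> R, [/\ measurable_fun setT g, forall w, `|g w| <= m &
    {ae P, forall w, h (X w) = g w}].
Proof.
move=> [XS mX] [_ ch] hm.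
(* Rational levels suffice to recover the composition and leave only countably many exceptional null
   sets. *)
have oU (q : rat) : metric_open inS dist [set x | inS x /\ ratr q < h x].
  split=> [x []//|x [Sx qx]].
  have [dl dl0 hdl] := ch x Sx (h x - ratr q) ltac:(by rewrite subr_gt0).
  exists dl => // y Sy xy; split=> //.
  have := hdl y Sy xy; have := ler_norm (h x - h y); lra.
have /choice [A /choice [N AN]] := fun q => mX _ (oU q).
have {}XS : P.-negligible (~` [set w | inS (X w)]) by [].
have nN : P.-negligible (~` [set w | inS (X w)] `|` \bigcup_n
    (if unpickle n is Some q then N q else set0)).
  apply: negligibleU => //; apply: negligible_bigcup => n.
  case: unpickle => [q|]; last exact: negligible_set0.
  by have [_ mN PN _] := AN q; apply/negligibleP.
have [N' [mN' PN' NN']] := nN.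
have inN' w : ~ N' w -> inS (X w) /\ forall q, A q w <-> ratr q < h (X w).
  move=> N'w; have iX : inS (X w).
    by apply: contrapT => SX; apply: N'w; apply: NN'; left.
  split=> // q; have [_ _ _ sN] := AN q.
  have nNq : ~ N q w.
    move=> Nq; apply: N'w; apply: NN'; right; exists (pickle q) => //.
    by rewrite pickleK.
  split=> [Aq|qh]; apply: contrapT => nh; apply: nNq; apply: sN.
    by right; split=> // -[].
  by left; split.
have mg : measurable_fun (~` N') (h \o X).
  move=> mD; apply: (measurability _ (RGenOInfty.measurableE R)) => //.
  move=> _ [_ [y ->] <-].
  rewrite (_ : _ `&` _ = ~` N' `&` \bigcup_(q in [set q : rat | y < ratr q]) A q).
    apply: measurableI => //; rewrite bigcup_mkcond.
    apply: bigcupT_measurable_rat => q; case: ifP => // _.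
    by have [] := AN q.
  apply/seteqP; split=> w /= [N'w]; rewrite in_itv/= andbT.
    move=> yh; split=> //; have [q] := rat_in_itvoo yh.
    rewrite in_itv/= => /andP[yq qh]; exists q => //.
    by apply/(inN' w N'w).2.
  move=> [q yq Aq]; split=> //; apply: lt_trans yq _.
  by apply/(inN' w N'w).2.
exists ((h \o X) \_ (~` N')); split.
- have mC := measurableC mN'; exact: (measurable_restrictT (h \o X) mC).1 mg.
- move=> w; rewrite patchE; case: ifP => _; first exact: hm.
  by rewrite normr0 (le_trans _ (hm (X w))).
- exists N'; split=> // w /= hw; apply: contrapT => N'w; apply: hw.
  by rewrite patchE mem_set.
Qed.

End outer_expectation.

(** * Lipschitz envelopes in a metric space *)

(** Distances are extended reals because a supremum distance between unbounded functions may be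
    infinite; finiteness is asked only between points of the space. *)
Definition metric_on {R : realType} {D : Type} (inS : D -> Prop)
    (dist : D -> D -> \bar R) : Prop :=
  [/\ forall x, dist x x = 0%E, forall x y, (0 <= dist x y)%E,
      forall x y, dist x y = dist y x,
      forall x y z, (dist x z <= dist x y + dist y z)%E &
      forall x y, inS x -> inS y -> dist x y \is a fin_num].

Section envelope.
Context {R : realType} {D : Type} (inS : D -> Prop) (dist : D -> D -> \bar R).
Context (Om : nat -> Type) (X : forall n, Om n -> D).
Context (phi : forall n, Om n -> R) (m : R).

(* Lipschitz majorant of all the phi n, n >= k, seen as functions of X n. *)
Definition envelope (k : nat) (x : D) : R :=
  sup [set z | z = - m \/ exists n (w : Om n), (k <= n)%N /\
                 z = phi n w - k%:R * fine (dist x (X n w))].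

Hypothesis md : metric_on inS dist.
Hypothesis XS : forall n w, inS (X n w).
Hypothesis phim : forall n w, `|phi n w| <= m.
Hypothesis m0 : 0 <= m.

(** The extra candidate - m keeps the set nonempty; the penalty is nonnegative, so [m] is an upper
    bound. *)
Lemma envelope_has_sup k x :
  has_sup [set z | z = - m \/ exists n (w : Om n), (k <= n)%N /\
                 z = phi n w - k%:R * fine (dist x (X n w))].
Proof.
have [_ d0 _ _ _] := md; split; first by exists (- m); left.
suff ub z : (z = - m \/ exists n (w : Om n), (k <= n)%N /\
    z = phi n w - k%:R * fine (dist x (X n w))) -> z <= m by exists m.
move=> [->|[n [w [_ ->]]]]; first by have := m0; lra.
have dk : 0 <= k%:R * fine (dist x (X n w)) by rewrite mulr_ge0// fine_ge0.
have := phim n w; rewrite ler_norml; lra.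
Qed.

Lemma envelope_le k x c : - m <= c ->
  (forall n w, (k <= n)%N -> phi n w - k%:R * fine (dist x (X n w)) <= c) ->
  envelope k x <= c.
Proof.
move=> mc H; apply: ge_sup; first exact: (envelope_has_sup k x).1.
by move=> z [->//|[n [w [kn ->]]]]; exact: H.
Qed.

Lemma envelope_ge k x n w : (k <= n)%N ->
  phi n w - k%:R * fine (dist x (X n w)) <= envelope k x.
Proof.
move=> kn; apply: ub_le_sup; first exact: (envelope_has_sup k x).2.
by right; exists n, w.
Qed.

Lemma envelope_bound k x : `|envelope k x| <= m.
Proof.
have [_ d0 _ _ _] := md; rewrite ler_norml; apply/andP; split.
  by apply: ub_le_sup; [exact: (envelope_has_sup k x).2|left].
apply: envelope_le => [|n w kn]; first by have := m0; lra.
have dk : 0 <= k%:R * fine (dist x (X n w)) by rewrite mulr_ge0// fine_ge0.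
have := phim n w; rewrite ler_norml; lra.
Qed.

(** Each penalised candidate is [k]-Lipschitz in [x] by the triangle inequality, and a supremum
    keeps the constant. *)
Lemma envelope_lip k x y : inS x -> inS y ->
  envelope k x <= envelope k y + k%:R * fine (dist x y).
Proof.
move=> Sx Sy; have [_ d0 _ tri fd] := md.
have kd : 0 <= k%:R * fine (dist x y) by rewrite mulr_ge0// fine_ge0.
apply: envelope_le => [|n w kn].
  by have := envelope_bound k y; rewrite ler_norml; lra.
have := envelope_ge k y n w kn.
suff : k%:R * fine (dist y (X n w)) <=
       k%:R * fine (dist x y) + k%:R * fine (dist x (X n w)) by lra.
rewrite -mulrDr ler_wpM2l// -fineD ?fd//.
rewrite fine_le ?fin_numD ?fd//.
by apply: le_trans (tri y x (X n w)) _; case: md => _ _ -> _ _.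
Qed.

Lemma envelope_bcont k : bcont inS dist (envelope k).
Proof.
split; first by exists m; exact: envelope_bound.
move=> x Sx e e0; have [_ d0 sym tri fd] := md.
(* The divisor [k.+1] instead of [k] covers the case k = 0. *)
exists (e / k.+1%:R) => [|y Sy]; first by rewrite divr_gt0.
rewrite -(fineK (fd x y Sx Sy)) lte_fin ltr_pdivlMr// => xy.
have := envelope_lip k _ _ Sx Sy; have := envelope_lip k _ _ Sy Sx.
rewrite (sym y x); set t := fine _ in xy *.
have t0 : 0 <= t by rewrite fine_ge0.
have : k%:R * t <= t * k.+1%:R by rewrite mulrC ler_wpM2l// ler_nat.
move: (k%:R * t) (t * k.+1%:R) xy => a b ab ba l1 l2.
by rewrite ltr_norml; lra.
Qed.

(** Candidates within [dl] of [x] are at most [c] once k >= N. The others are penalised by at least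
    2 * m as soon as k * dl >= 2 * m, which brings them below - m. *)
Lemma envelope_near x c dl N : 0 < dl -> - m <= c ->
  (forall n w, (N <= n)%N -> fine (dist x (X n w)) < dl -> phi n w <= c) ->
  \forall k \near \oo, envelope k x <= c.
Proof.
move=> dl0 mc H; have [_ d0 sym tri fd] := md.
near=> k; apply: envelope_le => // n w kn.
have [lt|ge] := ltP (fine (dist x (X n w))) dl.
  have := H n w; rewrite lt; move/(_ _ isT).
  have dk : 0 <= k%:R * fine (dist x (X n w)) by rewrite mulr_ge0// fine_ge0.
  suff Nn : (N <= n)%N by move=> /(_ Nn); lra.
  by apply: leq_trans kn; near: k; exact: nbhs_infty_ge.
have k2 : 2 * m / dl <= k%:R by near: k; exact: nbhs_infty_ger.
have : 2 * m <= k%:R * fine (dist x (X n w)).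
  rewrite ler_pdivrMr// in k2; apply: le_trans k2 _.
  by rewrite ler_wpM2l.
by have := phim n w; rewrite ler_norml; lra.
Unshelve. all: by end_near. Qed.

End envelope.

(** * Extended continuous mapping for outer weak convergence *)

Section extended_continuous_mapping.
Context {R : realType} {D : Type} (inS : D -> Prop) (dist : D -> D -> \bar R).
Context {d : measure_display} {Om : nat -> measurableType d}.
Context (P : forall n, probability (Om n) R) (X : forall n, Om n -> D).
Context {d0 : measure_display} {Om0 : measurableType d0}.
Context (P0 : probability Om0 R) (Y : Om0 -> D).
Hypothesis md : metric_on inS dist.
Hypothesis XS : forall n w, inS (X n w).
Hypothesis XY : weak_conv inS dist P X P0 Y.

Lemma bounded_integrable (psi : Om0 -> R) (m : R) : measurable_fun setT psi ->
  (forall w, `|psi w| <= m) -> P0.-integrable setT (EFin \o psi).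
Proof.
move=> mpsi psim; apply: measurable_bounded_integrable => //.
  by rewrite ltey_eq fin_num_measure.
exists m; split; first exact: num_real.
by move=> x mx w _; apply: le_trans (psim w) (ltW mx).
Qed.

(** For fixed [k] the envelope is bounded, continuous, and dominates [phi n] along [X n] for all n
    >= k, so weak convergence bounds the outer expectations by its mean at [Y]. Then [k] is chosen
    by dominated convergence. *)
Lemma weak_conv_limsup (phi : forall n, Om n -> R) (psi : Om0 -> R) (m : R) :
  (forall n w, `|phi n w| <= m) -> measurable_fun setT psi ->
  (forall w, `|psi w| <= m) ->
  {ae P0, forall w0, forall e : R, 0 < e -> exists2 dl : R, 0 < dl &
     exists N, forall n w, (N <= n)%N -> (dist (Y w0) (X n w) < dl%:E)%E ->
       phi n w <= psi w0 + e} ->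
  forall e : R, 0 < e -> \forall n \near \oo,
    (outer_expect (P n) (phi n) < \int[P0]_w (psi w)%:E + e%:E)%E.
Proof.
move=> phim mpsi psim loc e e0; have [rY wc] := XY.
(* A point of [Om0] is wanted only to derive 0 <= m. *)
have [w0] : [set: Om0] !=set0.
  apply/set0P/negP => /eqP T0; have := probability_setT P0.
  by rewrite T0 measure0 => /eqP; rewrite eq_sym onee_eq0.
move=> _; have m0 : 0 <= m by apply: le_trans (psim w0).
have [_ d0' _ _ fd] := md.
have bc k := envelope_bcont _ _ _ X phi m md XS phim m0 k.
have bd k x := envelope_bound _ _ _ X phi m md phim m0 k x.
have /choice [g gP] : forall k, exists g : Om0 -> R,
    [/\ measurable_fun setT g, forall w, `|g w| <= m &
        {ae P0, forall w, envelope dist Om X phi m k (Y w) = g w}].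
  move=> k; exact: (bcont_random_elt_measurable P0 D inS dist Y _ m rY (bc k) (bd k)).
(* At [Y w] the envelope is only bounded above in the limit; the maximum with [psi] turns this into
   genuine convergence to [psi]. *)
pose f k w := Num.max (g k w) (psi w).
have mf k : measurable_fun setT (f k).
  by apply: measurable_maxr => //; have [] := gP k.
have aeg : {ae P0, forall w, forall k, envelope dist Om X phi m k (Y w) = g k w}.
  apply/ae_foralln => k; by have [] := gP k.
have cf : {ae P0, forall w, setT w -> (EFin \o f k) w @[k --> \oo] --> (psi w)%:E}.
  have [YS _] := rY.
  apply: filterS3 aeg loc YS => w gw lw SY _.
  apply: cvg_EFin; first exact: nearW.
  apply/cvgrPdist_le => eps eps0.
  have [dl dl0 [N HN]] := lw _ eps0.
  have := @envelope_near _ _ inS dist Om X phi m md phim m0 (Y w) (psi w + eps) dl N dl0.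
  have pw : - m <= psi w + eps by have := psim w; rewrite ler_norml; lra.
  move=> /(_ pw) [n v Nn|].
    move=> lt; apply: (HN n v Nn); rewrite -(fineK (fd _ _ SY (XS n v))).
    by rewrite lte_fin.
  move=> K _ HK; exists K => // k Kk /=.
  rewrite ler_norml /f; have := HK k Kk; rewrite /= gw.
  by case: (leP (g k w) (psi w)); lra.
have ig : P0.-integrable setT (EFin \o cst m) by exact: finite_measure_integrable_cst.
have fm : {ae P0, forall w k, setT w -> (`|(EFin \o f k) w| <= (EFin \o cst m) w)%E}.
  apply: aeW => w k _; rewrite /= lee_fin /f.
  by have [_ /(_ w) gm _] := gP k; case: (leP (g k w) (psi w)).
have [||ipsi _ cv] := dominated_convergence measurableT _ _ cf ig fm.
  by move=> k; exact/measurable_EFinP.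
  exact/measurable_EFinP.
have fi : (\int[P0]_w (psi w)%:E)%E \is a fin_num by exact: integrable_fin_num.
have lte : (\int[P0]_w (psi w)%:E < \int[P0]_w (psi w)%:E + e%:E)%E.
  by rewrite lteDl// lte_fin.
have [k _ /(_ k (leqnn k)) /= lk] := cv _ (open_ereal_lt' lte).
have lk2 : (outer_expect P0 (envelope dist Om X phi m k \o Y) <
            \int[P0]_w (psi w)%:E + e%:E)%E.
  apply: le_lt_trans lk; have [mg _ aegk] := gP k.
  rewrite (outer_expect_ae P0 _ _ mg)//.
  apply: ae_le_integral; [exact/measurable_EFinP|exact/measurable_EFinP|].
  by apply: aeW => w; rewrite lee_fin /f le_max lexx.
have := wc _ (bc k) _ (open_ereal_lt' lk2).
move=> near1; near=> n.
apply: (@le_lt_trans _ _ (outer_expect (P n) (envelope dist Om X phi m k \o X n))).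
  apply: le_outer_expect => w /=.
  have kn : (k <= n)%N by near: n; exact: nbhs_infty_ge.
  have [dxx _ _ _ _] := md.
  have := envelope_ge _ _ _ X phi m md phim m0 k (X n w) n w kn.
  by rewrite dxx mulr0 subr0.
by near: n.
Unshelve. all: by end_near. Qed.

(** For phi = 0 and m = 1 the envelope is minus the minimum of 1 and [k] times the distance to the
    values of the [X n], n >= k. It vanishes along these [X n], so its mean at [Y] is 0; being
    nonpositive, it vanishes almost surely at [Y]. *)
Lemma weak_conv_support : {ae P0, forall w0, forall (N : nat) (dl : R), 0 < dl ->
  exists n (w : Om n), (N <= n)%N /\ (dist (Y w0) (X n w) < dl%:E)%E}.
Proof.
have [rY wc] := XY; have [_ d0' _ _ fd] := md.
pose phi n (w : Om n) : R := 0.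
have phim n w : `|phi n w| <= 1 by rewrite normr0.
have bc k := envelope_bcont _ _ _ X phi 1 md XS phim ler01 k.
have bd k x := envelope_bound _ _ _ X phi 1 md phim ler01 k x.
have ek k x : envelope dist Om X phi 1 k x <= 0.
  apply: (envelope_le _ _ _ X phi 1 md phim ler01) => [|n w kn]; first by lra.
  by rewrite sub0r oppr_le0 mulr_ge0// fine_ge0.
have e0 : {ae P0, forall w, forall k, envelope dist Om X phi 1 k (Y w) = 0}.
  apply/ae_foralln => k.
  have [g [mg gm aeg]] :=
    bcont_random_elt_measurable P0 D inS dist Y _ 1 rY (bc k) (bd k).
  have c0 : outer_expect (P n) (envelope dist Om X phi 1 k \o X n) @[n --> \oo] --> 0%E.
    apply: (@cvg_near_cst _ _ 0%E) => //.
    near=> n; have kn : (k <= n)%N by near: n; exact: nbhs_infty_ge.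
    rewrite (outer_expect_ae (P n) _ (cst 0)) ?integral0//.
    apply: aeW => w; apply/eqP; rewrite eq_le ek/=.
    have [dxx _ _ _ _] := md.
    have := envelope_ge _ _ _ X phi 1 md phim ler01 k (X n w) n w kn.
    by rewrite dxx mulr0 subr0.
  have := @cvg_unique _ (@ereal_hausdorff R) _ _ _ _ (wc _ (bc k)) c0.
  rewrite (outer_expect_ae P0 _ _ mg)// => ig.
  have gle0 : {ae P0, forall w, g w <= 0} by apply: filterS aeg => w <-.
  have iabs : (\int[P0]_w `|(EFin \o g) w| = 0)%E.
    have -> : (0 = \int[P0]_w - (EFin \o g) w)%E.
      rewrite integralN/= ?ig ?oppe0//.
      by apply: integrable_add_def => //; exact: (bounded_integrable g 1).
    apply: ae_eq_integral => //.
    - by apply/measurable_EFinP; exact: measurableT_comp.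
    - by apply/measurable_EFinP; exact: measurableT_comp.
    - by apply: filterS gle0 => w g0 _; rewrite /= ler0_norm.
  have mEg : measurable_fun setT (EFin \o g) by exact/measurable_EFinP.
  have /(ae_eq_integral_abs P0 measurableT mEg) g0 := iabs.
  by apply: filterS2 aeg g0 => w -> /(_ I) [].
have [YS _] := rY.
apply: filterS2 e0 YS => w ew SY N dl dl0.
apply: contrapT => H.
(* k >= N discards small indices, and k > 0 makes the penalty at distance [dl] strictly positive. *)
pose k := maxn N (Num.bound (1 / dl)).
suff : envelope dist Om X phi 1 k (Y w) < 0 by rewrite ew ltxx.
apply: (@le_lt_trans _ _ (- Num.min 1 (k%:R * dl))).
  apply: (envelope_le _ _ _ X phi 1 md phim ler01) => [|n v kn].
    by rewrite lerN2 ge_min lexx.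
  rewrite sub0r lerN2 ge_min; apply/orP; right; rewrite ler_wpM2l//.
  rewrite leNgt; apply/negP => lt; apply: H; exists n, v; split.
    by apply: leq_trans kn; rewrite leq_maxl.
  by rewrite -(fineK (fd _ _ SY (XS n v))) lte_fin.
rewrite oppr_lt0 lt_min ltr01/= mulr_gt0//.
rewrite (lt_le_trans (_ : 0 < (Num.bound (1 / dl))%:R))// ?ler_nat ?leq_maxr//.
Unshelve. all: by end_near. Qed.

(** The one-sided bound is applied to [h] along [Z n] and to its opposite; the second gives the
    lower bound on the outer expectation. *)
Lemma weak_conv_local (E : Type) (inS' : E -> Prop) (dist' : E -> E -> \bar R)
    (Z : forall n, Om n -> E) (Z0 : Om0 -> E) :
  (forall n w, inS' (Z n w)) -> random_elt P0 inS' dist' Z0 ->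
  {ae P0, forall w0, forall e : R, 0 < e -> exists2 dl : R, 0 < dl &
     exists N, forall n w, (N <= n)%N -> (dist (Y w0) (X n w) < dl%:E)%E ->
       (dist' (Z0 w0) (Z n w) < e%:E)%E} ->
  weak_conv inS' dist' P Z P0 Z0.
Proof.
move=> ZS rZ loc; split=> // h ch; have [[m hm] cth] := ch.
have [psi [mpsi psim aepsi]] := bcont_random_elt_measurable P0 E inS' dist' Z0 h m rZ ch hm.
have aZ : {ae P0, forall w0, forall e : R, 0 < e -> exists2 dl : R, 0 < dl &
     exists N, forall n w, (N <= n)%N -> (dist (Y w0) (X n w) < dl%:E)%E ->
       `|psi w0 - h (Z n w)| < e}.
  have [ZS0 _] := rZ.
  apply: filterS3 loc ZS0 aepsi => w0 loc0 S0 <- e e0.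
  have [dl' dl'0 H] := cth _ S0 _ e0.
  have [dl dl0 [N HN]] := loc0 _ dl'0.
  exists dl => //; exists N => n w Nn dn.
  by apply: H => //; exact: HN.
have fi : (\int[P0]_w (psi w)%:E)%E \is a fin_num.
  apply: integrable_fin_num => //; exact: (bounded_integrable psi m).
have up e : 0 < e -> \forall n \near \oo,
    (outer_expect (P n) (h \o Z n) < \int[P0]_w (psi w)%:E + e%:E)%E.
  apply: (weak_conv_limsup (fun n w => h (Z n w)) psi m) => //.
  apply: filterS aZ => w0 H e' e'0; have [dl dl0 [N HN]] := H _ e'0.
  exists dl => //; exists N => n w Nn dn; have := HN n w Nn dn.
  by rewrite ltr_norml; lra.
have lo e : 0 < e -> \forall n \near \oo,
    (outer_expect (P n) (fun w => - h (Z n w))%R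
     < \int[P0]_w (- psi w)%:E + e%:E)%E.
  apply: (weak_conv_limsup (fun n w => - h (Z n w)) (fun w => - psi w) m) => //.
  - by move=> n w; rewrite normrN.
  - exact: measurableT_comp.
  - by move=> w; rewrite normrN.
  apply: filterS aZ => w0 H e' e'0; have [dl dl0 [N HN]] := H _ e'0.
  exists dl => //; exists N => n w Nn dn; have := HN n w Nn dn.
  by rewrite ltr_norml; lra.
have iN : (\int[P0]_w (- psi w)%:E = - \int[P0]_w (psi w)%:E)%E.
  rewrite -integralN//; apply: integrable_add_def => //.
  exact: (bounded_integrable psi m).
rewrite (outer_expect_ae P0 _ _ mpsi) => //.
rewrite iN in lo; rewrite -(fineK fi) in lo up *; set l := fine _ in lo up *.
have bds e : 0 < e -> \forall n \near \oo,
    ((l - e)%:E < outer_expect (P n) (h \o Z n) < (l + e)%:E)%E.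
  move=> e0; apply: filterS2 (up _ e0) (lo _ e0) => n -> /= lt; rewrite andbT.
  have := outer_expectN_le (P n) (h \o Z n) m (fun w => hm (Z n w)).
  apply: lt_le_trans; rewrite lteNr; apply: lt_le_trans lt _.
  by rewrite -EFinD -EFinN opprB addrC.
apply: cvg_EFin.
  apply: filterS (bds 1 ltr01) => n /andP[l1 l2].
  by rewrite fin_real// (lt_trans _ l1) ?(lt_trans l2)// ?ltNyr// ltry.
apply/cvgrPdist_lt => e e0; apply: filterS (bds _ e0) => n /=.
case: (outer_expect _ _) => [x| |] /andP[] /=.
- by rewrite !lte_fin ltr_norml; lra.
- by move=> _; rewrite ltNge leey.
- by rewrite ltNge leNye.
Qed.

(** Up to a null set, the preimage of an open set under [Z0] is the preimage under [Y] of an open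
    set, because on [G] the value of [Z0] varies continuously with that of [Y]. *)
Lemma random_elt_local (E : Type) (inS' : E -> Prop) (dist' : E -> E -> \bar R)
    (Z0 : Om0 -> E) (G : set Om0) :
  {ae P0, forall w, G w} -> {ae P0, forall w, inS' (Z0 w)} ->
  (forall w0, G w0 -> forall e : R, 0 < e -> exists2 dl : R, 0 < dl &
     forall w, G w -> (dist (Y w0) (Y w) < dl%:E)%E ->
       (dist' (Z0 w0) (Z0 w) < e%:E)%E) ->
  random_elt P0 inS' dist' Z0.
Proof.
move=> aG aS loc; split=> // U [US oU]; have [[YS mY] _] := XY.
have [dxx d0' _ tri fd] := md.
(* [Z0] is not presented as a function of [Y], so [V] is the union of the balls around good values
   [Y w0] all of whose good outcomes are sent into [U]. *)
pose V := [set x | inS x /\ exists w0 (dl : R), [/\ G w0,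
  forall w, G w -> inS' (Z0 w) -> (dist (Y w0) (Y w) < dl%:E)%E -> U (Z0 w) &
  (dist (Y w0) x < dl%:E)%E]].
have oV : metric_open inS dist V.
  split=> [x []//|x [Sx [w0 [dl [Gw0 H lt]]]]].
  have fx : dist (Y w0) x \is a fin_num.
    by rewrite ge0_fin_numE// (lt_trans lt)// ltry.
  rewrite -(fineK fx) lte_fin in lt.
  exists (dl - fine (dist (Y w0) x)) => [|y Sy xy]; first by rewrite subr_gt0.
  split=> //; exists w0, dl; split=> //; apply: le_lt_trans (tri _ x _) _.
  by move: xy; rewrite EFinB -{2}(fineK fx) lteBrDr//= addeC.
have [A [N [mA mN PN sub]]] := mY V oV.
have : P0.-negligible (N `|` ~` [set w | G w /\ inS (Y w) /\ inS' (Z0 w)]).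
  apply: negligibleU; first exact/negligibleP.
  have : {ae P0, forall w, G w /\ inS (Y w) /\ inS' (Z0 w)} by apply: filterS3 aG YS aS.
  exact.
move=> [N' [mN' PN' sN']]; exists A, N'; split => // w Hw; apply: sN'.
have [[Gw [Sw S'w]]|nG] := pselect (G w /\ inS (Y w) /\ inS' (Z0 w)); last by right.
left; apply: sub.
have UV : U (Z0 w) <-> V (Y w).
  split=> [Uw|[_ [w0 [dl [Gw0 H lt]]]]]; last exact: H.
  split=> //; have [e e0 He] := oU _ Uw; have [dl dl0 Hdl] := loc w Gw e e0.
  exists w, dl; split=> //; last by rewrite dxx lte_fin.
  by move=> w' Gw' S'w' lt; apply: He => //; exact: Hdl.
case: Hw => -[H1 H2]; [left; split=> //; exact/UV|right; split=> //].
by move=> /UV H3; apply: H2.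
Qed.

End extended_continuous_mapping.

(** * Univariate distribution functions and their quantiles *)

Section cdf1_theory.
Context {R : realType} (mu : probability R R).

(** Viewing the identity as a random variable makes [cdf1 mu] its distribution function, whose tail
    limits and right continuity are then inherited. *)
Let idR : R -> R := idfun.

#[local] HB.instance Definition _ :=
  @isMeasurableFun.Build _ _ _ _ idR (@measurable_id _ _ setT).

Lemma cdf1E : cdf1 mu = fine \o cdf (idR : {RV mu >-> R}).
Proof. by []. Qed.

Lemma cdf1_nondecreasing : {homo cdf1 mu : x y / x <= y}.
Proof.
move=> x y xy; rewrite cdf1E /= fine_le ?fin_num_measure//.
exact: cdf_nondecreasing.
Qed.

Lemma cdf1_ge0 x : 0 <= cdf1 mu x. Proof. by rewrite /cdf1 fine_ge0. Qed.

Lemma cdf1_le1 x : cdf1 mu x <= 1.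
Proof.
by rewrite -lee_fin /cdf1 fineK ?fin_num_measure// probability_le1.
Qed.

Lemma cdf1_tail_ninfty (e : R) : 0 < e -> exists a, forall x, x <= a -> cdf1 mu x < e.
Proof.
move=> e0.
have /fine_cvg /cvgrPdist_lt /(_ _ e0) : cdf (idR : {RV mu >-> R}) @ -oo%R --> 0%:E.
  exact: cvg_cdfNy0.
move=> [a [_ Ha]]; exists (a - 1) => x xa.
have /Ha : x < a by rewrite (le_lt_trans xa)// ltrBlDr ltrDl.
by rewrite sub0r normrN; apply: le_lt_trans; exact: ler_norm.
Qed.

Lemma cdf1_tail_pinfty (e : R) : 0 < e ->
  exists a, forall x, a <= x -> 1 - cdf1 mu x < e.
Proof.
move=> e0.
have /fine_cvg /cvgrPdist_lt /(_ _ e0) : cdf (idR : {RV mu >-> R}) @ +oo%R --> 1%:E.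
  exact: cvg_cdfy1.
move=> [a [_ Ha]]; exists (a + 1) => x xa.
have /Ha : a < x by rewrite (lt_le_trans _ xa)// ltrDl.
by apply: le_lt_trans; exact: ler_norm.
Qed.

Lemma cdf1_right_continuous x (e : R) : 0 < e ->
  exists2 y, x < y & cdf1 mu y < cdf1 mu x + e.
Proof.
move=> e0.
have : cdf (idR : {RV mu >-> R}) r @[r --> x^'+] --> (cdf1 mu x)%:E.
  rewrite cdf1E /= fineK ?fin_num_measure//.
  exact: (@cdf_right_continuous _ _ _ mu (idR : {RV mu >-> R}) x).
move=> /fine_cvg /cvgrPdist_lt /(_ _ e0) H.
have [y [xy Hy]] := @filter_ex _ _ (at_right_proper_filter x) _ (filterI (nbhs_right_gt x) H).
have {}Hy : `|cdf1 mu x - cdf1 mu y| < e := Hy.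
by exists y => //; move: Hy; rewrite ltr_norml; lra.
Qed.

Lemma cdf1e_fin x : cdf1e mu x%:E = cdf1 mu x.
Proof.
rewrite /cdf1e /cdf1; congr (fine (mu _)).
Qed.

Lemma cdf1e_pinfty : cdf1e mu +oo%E = 1.
Proof.
rewrite /cdf1e (_ : [set _ | _] = setT) ?probability_setT//.
by apply/seteqP; split=> x //= _; exact: leey.
Qed.

Lemma cdf1e_ninfty : cdf1e mu -oo%E = 0.
Proof.
rewrite /cdf1e (_ : [set _ | _] = set0) ?measure0//.
by apply/seteqP; split=> x.
Qed.

Lemma cdf1e_itv y : 0 <= cdf1e mu y <= 1.
Proof.
case: y => [x||]; rewrite ?cdf1e_fin ?cdf1e_pinfty ?cdf1e_ninfty ?lexx ?ler01//.
by rewrite cdf1_ge0 cdf1_le1.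
Qed.

Lemma cdf1_lt_qf u x : (x%:E < qf mu u)%E -> cdf1 mu x < u.
Proof.
move=> xq; rewrite ltNge; apply/negP => ux; move: xq; rewrite ltNge.
by move/negP; apply; apply: ereal_inf_lbound; exists x.
Qed.

Lemma qf_lt u x : (qf mu u < x%:E)%E -> u <= cdf1 mu x.
Proof.
move=> /ereal_inf_lt [_ [y /= uy <-]]; rewrite lte_fin => yx.
by apply: le_trans uy _; exact/cdf1_nondecreasing/ltW.
Qed.

(** At a finite quantile this is right continuity; if the quantile is -oo, every value of the
    distribution function is at least [u], and the left tail forces u <= 0. Jumps are allowed, as is
    needed for the estimators. *)
Lemma cdf1e_qf_ge u : u <= 1 -> u <= cdf1e mu (qf mu u).
Proof.
move=> u1; case E : (qf mu u) => [y||]; rewrite ?cdf1e_fin ?cdf1e_pinfty ?cdf1e_ninfty//.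
  apply/ler_addgt0Pr => e e0; have [z yz zl] := cdf1_right_continuous y e e0.
  apply: le_trans (ltW zl); apply: qf_lt; by rewrite E lte_fin.
apply/ler_addgt0Pr => e e0; rewrite add0r.
have [a Ha] := cdf1_tail_ninfty e e0.
by apply: le_trans (ltW (Ha a (lexx a))); apply: qf_lt; rewrite E ltNyr.
Qed.

(** Real points approaching an extended real as [k] grows; they carry bounds known on [R] to the
    points at infinity. *)
Definition trunc (k : nat) (y : \bar R) : R :=
  match y with r%:E => r | +oo%E => k%:R | -oo%E => - k%:R end.

Lemma cdf1_trunc_cvg (y : \bar R) (e : R) : 0 < e ->
  \forall k \near \oo, `|cdf1e mu y - cdf1 mu (trunc k y)| <= e.
Proof.
move=> e0; case: y => [y||] /=.
- by apply: nearW => k; rewrite cdf1e_fin subrr normr0 ltW.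
- have [a Ha] := cdf1_tail_pinfty e e0; near=> k.
  rewrite cdf1e_pinfty ger0_norm ?subr_ge0 ?cdf1_le1//; apply/ltW/Ha.
  near: k; exact: nbhs_infty_ger.
- have [a Ha] := cdf1_tail_ninfty e e0; near=> k.
  rewrite cdf1e_ninfty sub0r normrN ger0_norm ?cdf1_ge0//; apply/ltW/Ha.
  rewrite lerNl; near: k; exact: nbhs_infty_ger.
Unshelve. all: by end_near. Qed.

Section continuous_cdf.
Hypothesis cF : continuous (cdf1 mu).

(** The strict inequality matters: only strictly below a quantile is the distribution function known
    to be less than [u]. *)
Lemma cdf1_left_approx (y : \bar R) (e : R) : y != -oo%E -> 0 < e ->
  exists2 x : R, (x%:E < y)%E & `|cdf1e mu y - cdf1 mu x| < e.
Proof.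
case: y => [y||]// _ e0.
  have /cvgrPdist_lt /(_ _ e0) := cF y.
  move=> /nbhs_ballP [d /= d0 Hd]; exists (y - d / 2).
    by rewrite lte_fin ltrBlDr ltrDl divr_gt0.
  rewrite cdf1e_fin; apply: Hd; rewrite /ball/= opprB addrC subrK gtr0_norm ?divr_gt0//.
  by rewrite ltr_pdivrMr// mulr_natr mulr2n ltrDl.
have [a Ha] := cdf1_tail_pinfty e e0; exists a; first exact: ltry.
by rewrite cdf1e_pinfty ger0_norm ?subr_ge0 ?cdf1_le1//; exact: Ha.
Qed.

Lemma cdf1e_qf u : 0 <= u <= 1 -> cdf1e mu (qf mu u) = u.
Proof.
move=> /andP[u0 u1]; apply/eqP; rewrite eq_le cdf1e_qf_ge// andbT.
have [->|qN] := eqVneq (qf mu u) -oo%E; first by rewrite cdf1e_ninfty.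
apply/ler_addgt0Pr => e e0; have [x xq] := cdf1_left_approx _ _ qN e0.
by have := cdf1_lt_qf _ _ xq; rewrite ltr_norml; lra.
Qed.

Lemma cdf1e_continuous : continuous (cdf1e mu).
Proof.
move=> y; apply/cvgrPdist_lt => e e0; case: y => [x||].
- have /cvgrPdist_lt /(_ _ e0) H := cF x.
  (* Neighbourhoods of a finite extended real are read off from those of the real number. *)
  change (nbhs x (fun t : R => `|cdf1e mu x%:E - cdf1e mu t%:E| < e)).
  by apply: filterS H => t; rewrite !cdf1e_fin.
- have [a Ha] := cdf1_tail_pinfty e e0.
  exists a; split; first exact: num_real.
  case=> [t||]//; rewrite ?cdf1e_pinfty ?subrr ?normr0//.
  rewrite lte_fin cdf1e_fin => at_.
  by rewrite ger0_norm ?subr_ge0 ?cdf1_le1//; exact/Ha/ltW.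
- have [a Ha] := cdf1_tail_ninfty e e0.
  exists a; split; first exact: num_real.
  case=> [t||]//; rewrite ?cdf1e_ninfty ?subrr ?normr0//.
  rewrite lte_fin cdf1e_fin => at_.
  by rewrite sub0r normrN ger0_norm ?cdf1_ge0//; exact/Ha/ltW.
Qed.

End continuous_cdf.
End cdf1_theory.

(** * Multivariate distribution functions *)

Section finite_union_bound.
Context {R : realType} {d : measure_display} {T : measurableType d}.
Context (mu : probability T R).

Lemma fine_probability_le_sum (I : finType) (A B : set T) (C : I -> set T) :
  measurable A -> measurable B -> (forall j, measurable (C j)) ->
  (forall z, A z -> B z \/ exists j, C j z) ->
  fine (mu A) <= fine (mu B) + \sum_j fine (mu (C j)).
Proof.
move=> mA mB mC ABC.
have mU r : measurable (\big[setU/set0]_(j <- r) C j) by exact: bigsetU_measurable.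
have Ur (r : seq I) :
    (mu (\big[setU/set0]_(j <- r) C j) <= \sum_(j <- r) mu (C j))%E.
  elim: r => [|j r IH]; first by rewrite !big_nil measure0.
  rewrite !big_cons; apply: le_trans (measureU2 _ _ _) _ => //.
  by rewrite leeD2l.
rewrite -lee_fin EFinD -sumEFin !fineK ?fin_num_measure//.
under eq_bigr => j _ do rewrite fineK ?fin_num_measure//.
apply: (@le_trans _ _ (mu (B `|` \big[setU/set0]_j C j))).
  apply: le_measure; rewrite ?inE//; first exact: measurableU.
  move=> z /ABC [Bz|[j Cj]]; [by left|right].
  by rewrite (bigD1 j)//=; left.
by apply: le_trans (measureU2 _ _ _) _ => //; rewrite leeD2l//; exact: Ur.
Qed.

End finite_union_bound.

Section cdfp_theory.
Context {R : realType} {p : nat}.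

Lemma ler_norm_coord (u : 'rV[R]_p) i : `|u ord0 i| <= `|u|.
Proof.
by rewrite [leRHS]/Num.norm/= mx_normrE; apply/bigmax_geP; right; exists (ord0, i).
Qed.

Definition lowerset (j : 'I_p) (y : \bar R) : set (Rp p) :=
  [set z : Rp p | (((z : 'rV[R]_p) ord0 j)%:E <= y)%E].

Definition orthante (y : 'rV[\bar R]_p) : set (Rp p) :=
  [set z : Rp p | forall i, (((z : 'rV[R]_p) ord0 i)%:E <= y ord0 i)%E].

(** The generating orthants have real corners, so a half-space is the union over [k] of orthants
    whose remaining corner coordinates equal [k]. *)
Lemma measurable_lowerset j y : measurable (lowerset j y).
Proof.
case: y => [x||].
- rewrite (_ : lowerset _ _ = \bigcup_k [set z : Rp p | forall i,
    (z : 'rV[R]_p) ord0 i <= (\row_i (if i == j then x else k%:R)) ord0 i]).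
    apply: bigcupT_measurable => k; apply: sub_sigma_algebra.
    by exists (\row_i (if i == j then x else k%:R)).
  apply/seteqP; split=> z.
    rewrite /lowerset/= lee_fin => zx.
    exists (Num.bound (`|(z : 'rV[R]_p)|)) => // i; rewrite mxE.
    case: ifPn => [/eqP ->//|_].
    apply: le_trans (ler_norm _) _; apply: le_trans (_ : `|(z : 'rV[R]_p)| <= _).
      exact: ler_norm_coord.
    by apply/ltW/archi_boundP.
  by move=> [k _ /(_ j)]; rewrite mxE eqxx /lowerset/= lee_fin.
- rewrite (_ : lowerset _ _ = setT)//.
  by apply/seteqP; split=> z //= _; rewrite /lowerset/= leey.
- rewrite (_ : lowerset _ _ = set0)//.
  by apply/seteqP; split=> z.
Qed.

Lemma measurable_orthante y : measurable (orthante y).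
Proof.
rewrite (_ : orthante y = \bigcap_(i in [set: 'I_p]) lowerset i (y ord0 i)).
  by apply: fin_bigcap_measurable => // i _; exact: measurable_lowerset.
by apply/seteqP; split=> z H i; [move=> _; exact: H|exact: H].
Qed.

Lemma cdfpE (mu : probability (Rp p) R) x :
  cdfp mu x = fine (mu (orthante (\row_i (x ord0 i)%:E))).
Proof.
rewrite /cdfp; congr (fine (mu _)); apply/seteqP; split=> z H i.
  by rewrite mxE lee_fin; exact: H.
by have := H i; rewrite mxE lee_fin.
Qed.

Lemma cdfpe_itv (mu : probability (Rp p) R) y : 0 <= cdfpe mu y <= 1.
Proof.
have my := measurable_orthante y.
rewrite fine_ge0//= -lee_fin fineK ?probability_le1// fin_num_measure//.
Qed.

Lemma cdfp_itv (mu : probability (Rp p) R) x : 0 <= cdfp mu x <= 1.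
Proof. rewrite cdfpE; exact: cdfpe_itv. Qed.

(** Complement of the box of points with all coordinates in ]-k, k]. Inside the box, replacing an
    infinite corner coordinate by its truncation does not change membership in the orthant. *)
Let tail (k : nat) : set (Rp p) :=
  \bigcup_(j in [set: 'I_p]) (lowerset j (- k%:R)%:E `|` ~` lowerset j k%:R%:E).

Let measurable_tail k : measurable (tail k).
Proof.
apply: fin_bigcup_measurable => // j _; apply: measurableU.
  exact: measurable_lowerset.
by apply: measurableC; exact: measurable_lowerset.
Qed.

Let tail_cvg (mu : probability (Rp p) R) (e : R) : 0 < e ->
  \forall k \near \oo, fine (mu (tail k)) <= e.
Proof.
move=> e0.
have cap0 : \bigcap_k tail k = set0.
  apply/seteqP; split=> // z tz.
  have [j _] := tz (Num.bound (`|(z : 'rV[R]_p)|)) I.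
  set k := Num.bound _; rewrite /lowerset/= !lee_fin.
  have zk : `|(z : 'rV[R]_p) ord0 j| < k%:R.
    apply: le_lt_trans (_ : `|(z : 'rV[R]_p)| < _); last exact/archi_boundP.
    exact: ler_norm_coord.
  by move: zk; rewrite ltr_norml => zk; case=> [|/negP]; lra.
have nt : nonincreasing_seq tail.
  apply/nonincreasing_seqP => k; apply/subsetPset => z [j _ H]; exists j => //.
  case: H => H; [left|right].
    move: H; rewrite /lowerset/= !lee_fin => /le_trans; apply.
    by rewrite lerN2 ler_nat.
  move=> H'; apply: H; move: H'; rewrite /lowerset/= !lee_fin => /le_trans; apply.
  by rewrite ler_nat.
have := @nonincreasing_cvg_mu _ _ _ mu tail.
rewrite cap0 measure0 => /(_ _ measurable_tail measurable0 nt).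
have m0 : (mu (tail 0%N) < +oo)%E by rewrite ltey_eq fin_num_measure.
move=> /(_ m0) /fine_cvg /cvgrPdist_le /(_ _ e0).
apply: filterS => k /=; rewrite sub0r normrN ger0_norm//.
exact: fine_ge0.
Qed.

Lemma cdfp_trunc_cvg (mu : probability (Rp p) R) (y : 'rV[\bar R]_p) (e : R) : 0 < e ->
  \forall k \near \oo, `|cdfpe mu y - cdfp mu (\row_i trunc k (y ord0 i))| <= e.
Proof.
move=> e0; apply: filterS (tail_cvg mu _ e0) => k tk.
rewrite cdfpE; set A := orthante _.
have mA : measurable A := measurable_orthante _.
have mB : measurable (orthante y) := measurable_orthante _.
(* The sum over one index puts the single exceptional set [tail k] in the form required by the union
   bound. *)
have l1 : fine (mu (orthante y)) <= fine (mu A) + \sum_(j < 1) fine (mu (tail k)).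
  apply: fine_probability_le_sum => // z zy.
  have [|nA] := pselect (A z); [by left|right; exists ord0].
  move: nA => /existsNP [i]; rewrite !mxE => /negP; rewrite -ltNge lte_fin => ti.
  exists i => //; have := zy i; case: (y ord0 i) ti => [r||]//=.
    by rewrite lee_fin => /lt_le_trans h /h; rewrite ltxx.
  by move=> ti _; right; rewrite /lowerset/= lee_fin; apply/negP; rewrite -ltNge.
have l2 : fine (mu A) <= fine (mu (orthante y)) + \sum_(j < 1) fine (mu (tail k)).
  apply: fine_probability_le_sum => // z zA.
  have [|ny] := pselect (orthante y z); [by left|right; exists ord0].
  move: ny => /existsNP [i] /negP; rewrite -ltNge => ti.
  exists i => //; have := zA i; rewrite !mxE lee_fin; case: (y ord0 i) ti => [r||]//=.
    by rewrite lte_fin => /lt_le_trans h /h; rewrite ltxx.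
  by move=> _ ti; left; rewrite /lowerset/= lee_fin.
rewrite big_ord1 in l1 l2.
change (cdfpe mu y) with (fine (mu (orthante y))).
by rewrite ler_norml; lra.
Qed.

Section margins.
Context (muH : probability (@Rp R p) R) (muF : 'I_p -> probability R R).
Hypothesis hmargin : forall (j : 'I_p) (x : R),
  cdf1 (muF j) x = cdfpe muH (\row_i (if i == j then x%:E else +oo%E)).

Lemma margin_lowerset j y : fine (muH (lowerset j y)) = cdf1e (muF j) y.
Proof.
case: y => [x||].
- rewrite cdf1e_fin hmargin; congr (fine (muH _)); apply/seteqP; split=> z.
    by move=> zj i; rewrite mxE; case: ifPn => [/eqP ->//|_]; exact: leey.
  by move=> /(_ j); rewrite mxE eqxx.
- rewrite cdf1e_pinfty (_ : lowerset _ _ = setT) ?probability_setT//.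
  by apply/seteqP; split=> z //= _; rewrite /lowerset/= leey.
- rewrite cdf1e_ninfty (_ : lowerset _ _ = set0) ?measure0//.
  by apply/seteqP; split=> z.
Qed.

(** A point in the orthant of [y] but not in that of [y'] lies, for some coordinate, in the strip
    between the two bounds, whose mass is an increment of that margin. *)
Let cdfpe_lipschitz1 y y' : cdfpe muH y <= cdfpe muH y' +
  \sum_j `|cdf1e (muF j) (y ord0 j) - cdf1e (muF j) (y' ord0 j)|.
Proof.
pose C j := lowerset j (y ord0 j) `\` lowerset j (y' ord0 j).
have mC j : measurable (C j) by apply: measurableD; exact: measurable_lowerset.
apply: le_trans (_ : fine (muH (orthante y')) + \sum_j fine (muH (C j)) <= _).
  apply: fine_probability_le_sum => //; try exact: measurable_orthante.
  move=> z zy; have [|/existsNP [j nj]] := pselect (orthante y' z); [by left|right].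
  by exists j; split=> //; exact: zy.
rewrite lerD2l; apply: ler_sum => j _.
have [yy'|y'y] := leP (y ord0 j) (y' ord0 j).
  rewrite (_ : C j = set0) ?measure0 ?normr_ge0//.
  by apply/seteqP; split=> // z [h1]; apply; exact: le_trans h1 yy'.
have mL k := measurable_lowerset j k.
rewrite -!margin_lowerset.
rewrite measureD//; last by rewrite ltey_eq fin_num_measure.
rewrite setIidr; last by move=> z /le_trans; apply; exact: ltW.
by rewrite fineB ?fin_num_measure// ler_norm.
Qed.

Lemma cdfpe_lipschitz y y' : `|cdfpe muH y - cdfpe muH y'| <=
  \sum_j `|cdf1e (muF j) (y ord0 j) - cdf1e (muF j) (y' ord0 j)|.
Proof.
have := cdfpe_lipschitz1 y y'; have := cdfpe_lipschitz1 y' y.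
under eq_bigr do rewrite distrC.
by rewrite ler_norml; lra.
Qed.

End margins.
End cdfp_theory.

(** * Compactness of the extended reals and uniform continuity on the cube *)

Section ereal_compact.
Context {R : realType}.

Lemma contract_expand (t : R) : contract (expand t) = Num.max (-1) (Num.min 1 t).
Proof.
have [t1|t1] := leP 1 t.
  by rewrite expand1//=; rewrite max_r//; lra.
have [tN1|tN1] := leP t (-1).
  by rewrite expandN1//= max_l.
by rewrite expandK ?max_r ?ltW// inE ler_norml; lra.
Qed.

(** Distances between extended reals are measured after [contract], so this reduces to clamping to
    [-1, 1] being 1-Lipschitz. *)
Lemma expand_continuous : continuous (@expand R).
Proof.
move=> t; apply/cvg_ballP => e e0; near=> s.
change (`|contract (expand t) - contract (expand s)| < e).
apply: le_lt_trans (_ : `|t - s| < e); last first.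
  by near: s; exact: (nbhsx_ballx t e e0).
rewrite !contract_expand.
have [? ?] : t - s <= `|t - s| /\ - (t - s) <= `|t - s|.
  by rewrite ler_norm -normrN ler_norm.
case: (leP 1 t) => ?; case: (leP 1 s) => ?; case: (leP (-1 : R) 1) => ?;
  case: (leP (-1) t) => ?; case: (leP (-1) s) => ?; rewrite ler_norml; lra.
Unshelve. all: by end_near. Qed.

Lemma ereal_compact : compact [set: \bar R].
Proof.
rewrite (_ : setT = @expand R @` `[-1, 1]).
  apply: continuous_compact; last exact: segment_compact.
  exact/continuous_subspaceT/expand_continuous.
apply/seteqP; split=> x // _; exists (contract x); last exact: contractK.
by rewrite /= in_itv/= -ler_norml contract_le1.
Qed.

End ereal_compact.

Section uniform_continuity.
Context {R : realType}.

(* Heine-Cantor through a quotient map: g identifies points, and a factors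
   through g. *)
Lemma compact_unif_continuous {T : topologicalType} {V : normedModType R}
    (K : set T) (g : T -> V) (a : T -> R) : compact K ->
  (forall s, K s -> forall e : R, 0 < e -> \forall t \near s, K t -> `|g s - g t| < e) ->
  (forall s, K s -> forall e : R, 0 < e -> \forall t \near s, K t -> `|a s - a t| < e) ->
  (forall s t, K s -> K t -> g s = g t -> a s = a t) ->
  forall e : R, 0 < e -> exists2 eta : R, 0 < eta &
    forall s t, K s -> K t -> `|g s - g t| <= eta -> `|a s - a t| <= e.
Proof.
move=> cK cg ca ga e e0.
(* Compactness as near-covering: a property holding for small [eta] near each pair holds for small
   [eta] at all pairs at once. *)
have /compact_near_coveringP /near_covering_withinP cKK := compact_setX cK cK.
have e2 : 0 < e / 2 by rewrite divr_gt0.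
have := cKK R 0^'+ (fun eta st => `|g st.1 - g st.2| <= eta -> `|a st.1 - a st.2| <= e)
  (at_right_proper_filter 0).
case.
  move=> [s t] [/= Ks Kt].
  (* If [g] identifies the two points, so does [a], and continuity of [a] suffices; otherwise [g]
     separates their neighbourhoods and the premise fails for small [eta]. *)
  have [gst|gst] := pselect (g s = g t).
    exists ([set s' | K s' -> `|a s - a s'| < e / 2] `*`
            [set t' | K t' -> `|a t - a t'| < e / 2], setT).
      split; last exact: filterT.
      by exists ([set s' | K s' -> `|a s - a s'| < e / 2],
                 [set t' | K t' -> `|a t - a t'| < e / 2]); [split; exact: ca|].
    move=> [[s' t'] i] /= [[As At] _] [/= Ks' Kt'] _.
    have := As Ks'; have := At Kt'; rewrite (ga s t)// !ltr_norml ler_norml; lra.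
  have c0 : 0 < `|g s - g t| by rewrite normr_gt0 subr_eq0; apply/eqP.
  (* Two moves below c / 4 and a gap below c / 2 would add up to less than [c]. *)
  set c := `|g s - g t| in c0; have c4 : 0 < c / 4 by rewrite divr_gt0.
  exists ([set s' | K s' -> `|g s - g s'| < c / 4] `*`
          [set t' | K t' -> `|g t - g t'| < c / 4], [set x | x < c / 2]).
    split; last by apply: nbhs_right_lt; rewrite divr_gt0.
    by exists ([set s' | K s' -> `|g s - g s'| < c / 4],
               [set t' | K t' -> `|g t - g t'| < c / 4]); [split; exact: cg|].
  move=> [[s' t'] i] /= [[As At] ic] [/= Ks' Kt'] gi.
  have : c <= `|g s - g s'| + `|g s' - g t'| + `|g t - g t'|.
    rewrite (distrC (g t)) /c (_ : g s - g t = g s - g s' + (g s' - g t') + (g t' - g t)).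
      by apply: le_trans (ler_normD _ _) _; rewrite lerD2r ler_normD.
    by rewrite !addrA !subrK.
  have := As Ks'; have := At Kt'; lra.
move=> eta /= eta0 H; exists (eta / 2); first by rewrite divr_gt0.
move=> s t Ks Kt; apply: (H (eta / 2) _ _ (s, t)) => //=.
  by rewrite sub0r normrN gtr0_norm ?divr_gt0// ltr_pdivrMr// mulr_natr mulr2n ltrDl.
by rewrite divr_gt0.
Qed.

Lemma rV_norm_le {p : nat} (u : 'rV[R]_p) (e : R) : 0 <= e ->
  (forall i, `|u ord0 i| <= e) -> `|u| <= e.
Proof.
move=> e0 H; rewrite [leLHS]/Num.norm/= mx_normrE; apply/bigmax_leP; split=> //.
by move=> [i j] _ /=; rewrite ord1.
Qed.

Lemma cube_compact {p : nat} : compact (@cube R p).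
Proof.
rewrite (_ : cube p = [set v : 'rV[R]_p | forall i, `[0, 1]%classic (v ord0 i)]).
  by apply: (@rV_compact R p (fun=> `[0, 1]%classic)) => i; exact: segment_compact.
by apply/seteqP; split=> u H i; have := H i; rewrite /= in_itv.
Qed.

(** The margins map a compact product of extended lines onto the cube, with the quantiles as a right
    inverse. *)
Lemma quotient_cube_unif_continuous {p : nat} (muF : 'I_p -> probability R R)
    (a : 'rV[R]_p -> R) : (forall j, continuous (cdf1 (muF j))) ->
  continuous (fun y : 'rV[\bar R]_p => a (\row_i cdf1e (muF i) (y ord0 i))) ->
  forall e : R, 0 < e -> exists2 eta : R, 0 < eta &
    forall u v, cube p u -> cube p v -> `|u - v| <= eta -> `|a u - a v| <= e.
Proof.
move=> cF ca e e0.
pose g (y : 'rV[\bar R]_p) := \row_i cdf1e (muF i) (y ord0 i).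
have cK : compact [set: 'rV[\bar R]_p].
  rewrite (_ : setT = [set v : 'rV[\bar R]_p | forall i, [set: \bar R] (v ord0 i)]).
    by apply: (@rV_compact (\bar R) p (fun=> setT)) => i; exact: ereal_compact.
  by apply/seteqP; split.
have [] := compact_unif_continuous setT g (a \o g) cK _ _ _ e e0.
- move=> s _ eps eps0.
  (* Neighbourhoods of a row vector are entrywise; eps / 2 leaves room because the norm estimate is
     not strict. *)
  exists (fun _ i => [set x | `|cdf1e (muF i) (s ord0 i) - cdf1e (muF i) x| < eps / 2]).
    move=> i j /=; rewrite (ord1 i).
    have /cvgrPdist_lt := cdf1e_continuous (muF j) (cF j) (s ord0 j).
    by apply; rewrite divr_gt0.
  move=> t H _; apply: le_lt_trans (_ : eps / 2 < eps); last first.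
    by rewrite ltr_pdivrMr// mulr_natr mulr2n ltrDl.
  apply: rV_norm_le => [|i]; first by rewrite divr_ge0// ltW.
  by rewrite !mxE; exact/ltW/H.
- move=> s _ eps eps0; have /cvgrPdist_lt /(_ _ eps0) := ca s.
  by apply: filterS.
- by move=> s t _ _ /= ->.
move=> eta eta0 H; exists eta => // u v cu cv uv.
have gq w : cube p w -> g (\row_i qf (muF i) (w ord0 i)) = w.
  by move=> cw; apply/rowP => i; rewrite !mxE cdf1e_qf.
rewrite -(gq u cu) -(gq v cv); apply: H => //.
by rewrite !gq.
Qed.

Lemma quotient_itv_unif_continuous (mu : probability R R) (b : R -> R) :
  continuous (cdf1 mu) -> continuous (fun y : \bar R => b (cdf1e mu y)) ->
  forall e : R, 0 < e -> exists2 eta : R, 0 < eta &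
    forall x y, 0 <= x <= 1 -> 0 <= y <= 1 -> `|x - y| <= eta -> `|b x - b y| <= e.
Proof.
move=> cF cb e e0.
have [] := compact_unif_continuous setT (cdf1e mu : _ -> R^o) (b \o cdf1e mu)
  ereal_compact _ _ _ e e0.
- move=> s _ eps eps0; have /cvgrPdist_lt /(_ _ eps0) := cdf1e_continuous mu cF s.
  by apply: filterS.
- move=> s _ eps eps0; have /cvgrPdist_lt /(_ _ eps0) := cb s.
  by apply: filterS.
- by move=> s t _ _ /= ->.
move=> eta eta0 H; exists eta => // x y x01 y01 xy.
rewrite -(cdf1e_qf mu cF x x01) -(cdf1e_qf mu cF y y01); apply: H => //.
by rewrite !cdf1e_qf.
Qed.

Lemma unif_continuous_within {V : normedModType R} (A : set V) (f : V -> R) :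
  (forall e : R, 0 < e -> exists2 eta : R, 0 < eta &
    forall u v, A u -> A v -> `|u - v| <= eta -> `|f u - f v| <= e) ->
  {within A, continuous f}.
Proof.
move=> H; apply/subspace_continuousP => u Au; apply/cvgrPdist_le => e e0.
have [eta eta0 He] := H e e0; apply/nbhs_ballP; exists eta => //= v.
by rewrite -ball_normE /= => uv Av; apply: He => //; exact: ltW.
Qed.

End uniform_continuity.

(** * Regularity of the copula and its partial derivatives *)

Section copula.
Context {R : realType} {p : nat} (muH : probability (@Rp R p) R).
Context (muF : 'I_p -> probability R R) (C : 'rV[R]_p -> R).
Hypothesis hmargin : forall (j : 'I_p) (x : R),
  cdf1 (muF j) x = cdfpe muH (\row_i (if i == j then x%:E else +oo%E)).
Hypothesis hFcont : forall j, continuous (cdf1 (muF j)).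
Hypothesis hC1 : forall u, cube p u -> C u = cdfpe muH (\row_i qf (muF i) (u ord0 i)).
Hypothesis hderiv : forall (j : 'I_p) u, Sj j u -> derivable C u (delta_mx 0 j).
Hypothesis hdcont : forall j : 'I_p,
  {within Sj j, continuous (fun u => 'D_(delta_mx 0 j) C u)}.

Lemma cube_cdf1e (y : 'rV[\bar R]_p) : cube p (\row_i cdf1e (muF i) (y ord0 i)).
Proof. by move=> i; rewrite mxE cdf1e_itv. Qed.

(** The quantile of F(y) may differ from [y], but it has the same margins, and the joint
    distribution function depends on its argument through the margins only. *)
Lemma copula_cdf (y : 'rV[\bar R]_p) :
  C (\row_i cdf1e (muF i) (y ord0 i)) = cdfpe muH y.
Proof.
rewrite hC1; last exact: cube_cdf1e.
apply/eqP; rewrite -subr_eq0 -normr_le0.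
apply: le_trans (cdfpe_lipschitz _ _ hmargin _ _) _.
rewrite big1// => i _; rewrite !mxE cdf1e_qf//; last exact: cdf1e_itv.
by rewrite subrr normr0.
Qed.

Lemma copula_lipschitz u v : cube p u -> cube p v ->
  `|C u - C v| <= \sum_j `|u ord0 j - v ord0 j|.
Proof.
move=> cu cv; rewrite !hC1//; apply: le_trans (cdfpe_lipschitz _ _ hmargin _ _) _.
by apply: ler_sum => i _; rewrite !mxE !cdf1e_qf.
Qed.

Definition upd (u : 'rV[R]_p) (j : 'I_p) (t : R) : 'rV[R]_p :=
  \row_i (if i == j then t else u ord0 i).

Lemma cube_upd u j t : cube p u -> 0 <= t <= 1 -> cube p (upd u j t).
Proof. by move=> cu t01 i; rewrite mxE; case: ifP. Qed.

Lemma upd_id u j : upd u j (u ord0 j) = u.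
Proof. by apply/rowP => i; rewrite mxE; case: eqP => [->|]. Qed.

Lemma updD u j t h : upd u j (h + t) = h *: delta_mx 0 j + upd u j t.
Proof.
apply/rowP => i; rewrite !mxE eqxx/=.
by case: eqP => _; rewrite ?mulr1 ?mulr0 ?add0r.
Qed.

Lemma copula_lipschitz_upd u j s t : cube p u -> 0 <= s <= 1 -> 0 <= t <= 1 ->
  `|C (upd u j s) - C (upd u j t)| <= `|s - t|.
Proof.
move=> cu s01 t01.
apply: le_trans (copula_lipschitz _ _ (cube_upd _ j _ cu s01) (cube_upd _ j _ cu t01)) _.
rewrite (bigD1 j)//= big1 => [|i ij]; first by rewrite !mxE eqxx addr0.
by rewrite !mxE (negbTE ij) subrr normr0.
Qed.

Lemma copula_deriv_le1 j u : Sj j u -> `|'D_(delta_mx 0 j) C u| <= 1.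
Proof.
move=> Su; have [cu /andP[u0 u1]] := Su.
rewrite leNgt; apply/negP => D1.
have e0 : 0 < `|'D_(delta_mx 0 j) C u| - 1 by rewrite subr_gt0.
have /cvgrPdist_lt /(_ _ e0) H : h^-1 *: ((C \o shift u) (h *: delta_mx 0 j) - C u)
    @[h --> 0^'] --> 'D_(delta_mx 0 j) C u by exact: hderiv.
(* The Lipschitz bound lives on the cube, so the increment must not leave it. *)
have k0 : 0 < Num.min (u ord0 j) (1 - u ord0 j) by rewrite lt_min u0 subr_gt0.
have near0 : \forall h \near (0 : R)^', `|h| < Num.min (u ord0 j) (1 - u ord0 j).
  by apply: dnbhs0_lt.
have [h [[h0 hk] hq]] := @filter_ex _ _ (Proper_dnbhs_numFieldType (0 : R)) _
   (filterI (filterI (nbhs_dnbhs_neq 0) near0) H).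
have := hq; rewrite /= -(upd_id u j) -updD => {}hq.
have hu : 0 <= h + u ord0 j <= 1.
  by move: hk; rewrite lt_min !ltr_norml; lra.
have hl := copula_lipschitz_upd u j _ _ cu hu (cu j).
rewrite addrK in hl.
have : `|h^-1 *: (C (upd u j (h + u ord0 j)) - C (upd u j (u ord0 j)))| <= 1.
  by rewrite normrZ normfV mulrC ler_pdivrMr ?mul1r// normr_gt0.
have := ler_dist_dist ('D_(delta_mx 0 j) C (upd u j (u ord0 j)))
  (h^-1 *: (C (upd u j (h + u ord0 j)) - C (upd u j (u ord0 j)))).
rewrite upd_id in hq *.
have := ler_norm (`|'D_(delta_mx 0 j) C u| -
   `|h^-1 *: (C (upd u j (h + u ord0 j)) - C u)|).
lra.
Qed.

(** Derivatives exist in the open interval; continuity at end points, possibly on a face of the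
    cube, comes from the Lipschitz bound. *)
Lemma copula_mvt j u a b : cube p u -> 0 <= a -> a < b -> b <= 1 ->
  exists2 c, a < c < b & C (upd u j b) - C (upd u j a) =
    'D_(delta_mx 0 j) C (upd u j c) * (b - a).
Proof.
move=> cu a0 ab b1.
have [] := @MVT R (fun s => C (upd u j s)) (fun s => 'D_(delta_mx 0 j) C (upd u j s)) a b ab.
- move=> x; rewrite in_itv/= => /andP[ax xb].
  have Sx : Sj j (upd u j x).
    split; first by apply: cube_upd => //; lra.
    by rewrite mxE eqxx; lra.
  have E : (fun h => h^-1 *:
      (((fun s => C (upd u j s)) \o shift x) (h *: (1 : R)) - C (upd u j x)))
    = (fun h => h^-1 *: ((C \o shift (upd u j x)) (h *: delta_mx 0 j) - C (upd u j x))).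
    by apply/funext => h /=; rewrite -updD /GRing.scale/= mulr1.
  apply: DeriveDef; last by rewrite /derive E.
  by rewrite /derivable E; exact: hderiv.
- apply: unif_continuous_within => e e0; exists e => // s t.
  rewrite /= !in_itv/= => s01 t01 st; apply: le_trans st.
  by apply: copula_lipschitz_upd => //; lra.
by move=> c; rewrite in_itv/=; exists c.
Qed.

Lemma copula_mvt_dist j u a b : cube p u -> 0 <= a <= 1 -> 0 <= b <= 1 -> a != b ->
  exists c, [/\ 0 < c < 1, `|c - a| <= `|b - a|, `|c - b| <= `|b - a| &
    C (upd u j b) - C (upd u j a) = 'D_(delta_mx 0 j) C (upd u j c) * (b - a)].
Proof.
move=> cu a01 b01; rewrite neq_lt => /orP[ab|ba].
  have [c cab E] := copula_mvt j u a b cu ltac:(lra) ab ltac:(lra).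
  exists c; rewrite E; split=> //; first by lra.
  - by rewrite (gtr0_norm (_ : 0 < b - a)) ?subr_gt0// ler_norml; lra.
  - by rewrite (gtr0_norm (_ : 0 < b - a)) ?subr_gt0// ler_norml; lra.
have [c cab E] := copula_mvt j u b a cu ltac:(lra) ba ltac:(lra).
exists c; split; first by lra.
- by rewrite (ltr0_norm (_ : b - a < 0)) ?subr_lt0// ler_norml; lra.
- by rewrite (ltr0_norm (_ : b - a < 0)) ?subr_lt0// ler_norml; lra.
- by rewrite -[LHS]opprB E -mulrN opprB.
Qed.

Section gamma.
Context (j : 'I_p) (b : R -> R) (b0 : b 0 = 0) (b1 : b 1 = 0).
Hypothesis bu : forall e : R, 0 < e -> exists2 eta : R, 0 < eta &
    forall x y, 0 <= x <= 1 -> 0 <= y <= 1 -> `|x - y| <= eta -> `|b x - b y| <= e.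

(** On the faces u_j = 0 and u_j = 1 nothing is known about the derivative, but the factor [b]
    vanishes. *)
Let gamma u := 'D_(delta_mx 0 j) C u * b (u ord0 j).

Lemma itv_bdry (x : R) : 0 <= x <= 1 -> [\/ 0 < x < 1, x = 0 | x = 1].
Proof.
move=> /andP[x0 x1]; have [->|nx0] := eqVneq x 0; first by constructor 2.
have [->|nx1] := eqVneq x 1; first by constructor 3.
by constructor 1; rewrite !lt_neqAle x0 x1 eq_sym nx0 nx1.
Qed.

Lemma deriv_mul_le u : cube p u -> `|gamma u| <= `|b (u ord0 j)|.
Proof.
move=> cu; rewrite /gamma; have [uj|->|->] := itv_bdry _ (cu j); last 2 first.
- by rewrite b0 mulr0.
- by rewrite b1 mulr0.
rewrite normrM ler_piMl//; exact: copula_deriv_le1.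
Qed.

(** Pointwise continuity on a compact set is enough. Off the faces it comes from that of both
    factors; at a face it follows from |gamma u| <= |b(u_j)|, which tends to 0. *)
Lemma deriv_mul_unif_continuous : forall e : R, 0 < e -> exists2 eta : R, 0 < eta &
  forall u v, cube p u -> cube p v -> `|u - v| <= eta -> `|gamma u - gamma v| <= e.
Proof.
have cid (s : 'rV[R]_p) (e : R) : 0 < e -> \forall t \near s, `|s - t| < e.
  by move=> e0; apply/nbhs_ballP; exists e => //= t; rewrite -ball_normE.
apply: (compact_unif_continuous (cube p) (fun x : 'rV[R]_p => x)) => //.
- exact: cube_compact.
- by move=> s _ e e0; apply: filterS (cid s e e0).
- move=> s cs e e0.
  have e2 : 0 < e / 2 by rewrite divr_gt0.
  have bdry : b (s ord0 j) = 0 -> \forall t \near s, cube p t -> `|gamma s - gamma t| < e.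
    move=> bs; have [eta eta0 H] := bu _ e2.
    apply: filterS (cid s eta eta0) => t st ct.
    rewrite /gamma bs mulr0 sub0r normrN.
    apply: le_lt_trans (deriv_mul_le t ct) _.
    have := H _ _ (cs j) (ct j); rewrite bs sub0r normrN.
    have : `|s ord0 j - t ord0 j| <= eta.
      by apply: le_trans (ltW st); have := ler_norm_coord (s - t) j; rewrite !mxE.
    by move=> h /(_ h); lra.
  have [sj|s0|s1] := itv_bdry _ (cs j); last 2 first.
  + by apply: bdry; rewrite s0.
  + by apply: bdry; rewrite s1.
  have B0 : 0 < `|b (s ord0 j)| + 1 by have := normr_ge0 (b (s ord0 j)); lra.
  (* Adding 1 keeps the divisor positive when [b] vanishes at this coordinate. *)
  set B := `|b (s ord0 j)| + 1 in B0.
  have eB : 0 < e / 2 / B by rewrite divr_gt0.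
  have /subspace_continuousP /(_ s (conj cs sj)) /cvgrPdist_lt /(_ _ eB) H1 := hdcont j.
  have [eta eta0 H2] := bu _ e2.
  have k0 : 0 < Num.min (s ord0 j) (1 - s ord0 j) by rewrite lt_min; lra.
  have H1' : \forall t \near s, Sj j t ->
      `|'D_(delta_mx 0 j) C s - 'D_(delta_mx 0 j) C t| < e / 2 / B.
    exact: H1.
  near=> t => ct.
  have stj : `|s ord0 j - t ord0 j| <= `|s - t|.
    by have := ler_norm_coord (s - t) j; rewrite !mxE.
  have sk : `|s - t| < Num.min (s ord0 j) (1 - s ord0 j) by near: t; exact: cid.
  have St : Sj j t.
    split=> //; have := le_lt_trans stj sk; rewrite lt_min !ltr_norml; lra.
  have h1 : `|'D_(delta_mx 0 j) C s - 'D_(delta_mx 0 j) C t| < e / 2 / B.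
    by apply: (near H1' t).
  have h2 : `|b (s ord0 j) - b (t ord0 j)| <= e / 2.
    apply: H2 => //; apply: le_trans stj _; apply: ltW; near: t; exact: cid.
  have -> : gamma s - gamma t =
      ('D_(delta_mx 0 j) C s - 'D_(delta_mx 0 j) C t) * b (s ord0 j) +
      'D_(delta_mx 0 j) C t * (b (s ord0 j) - b (t ord0 j)) by rewrite /gamma; ring.
  apply: le_lt_trans (ler_normD _ _) _; rewrite !normrM.
  have l2 : `|'D_(delta_mx 0 j) C t| * `|b (s ord0 j) - b (t ord0 j)| <= e / 2.
    by apply: le_trans h2; rewrite ler_piMl// copula_deriv_le1.
  have l1 : `|'D_(delta_mx 0 j) C s - 'D_(delta_mx 0 j) C t| * `|b (s ord0 j)| < e / 2.
    apply: le_lt_trans (_ : `|'D_(delta_mx 0 j) C s - 'D_(delta_mx 0 j) C t| * B < _).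
      by rewrite ler_wpM2l// /B lerDl.
    by rewrite -ltr_pdivlMr.
  lra.
- by move=> s t _ _ ->.
Unshelve. all: by end_near. Qed.

End gamma.

End copula.

(** * Estimators whose rescaled errors are uniformly close to given functions *)

Section estimators.
Context {R : realType} {p : nat} (muH : probability (@Rp R p) R).
Context (muF : 'I_p -> probability R R).
Hypothesis hFcont : forall j, continuous (cdf1 (muF j)).
Context (a : 'rV[R]_p -> R) (b : 'I_p -> R -> R).
Hypothesis au : forall e : R, 0 < e -> exists2 eta : R, 0 < eta &
    forall u v, cube p u -> cube p v -> `|u - v| <= eta -> `|a u - a v| <= e.
Hypothesis bu : forall (j : 'I_p) (e : R), 0 < e -> exists2 eta : R, 0 < eta &
    forall x y, 0 <= x <= 1 -> 0 <= y <= 1 -> `|x - y| <= eta -> `|b j x - b j y| <= e.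
Context (nuH : probability (@Rp R p) R) (nuF : 'I_p -> probability R R).
Context (r dl : R).
Hypothesis r0 : 0 < r.
Hypothesis aH : forall x : 'rV[R]_p,
  `|a (\row_i cdf1 (muF i) (x ord0 i)) - r * (cdfp nuH x - cdfp muH x)| <= dl.
Hypothesis bF : forall j x,
  `|b j (cdf1 (muF j) x) - r * (cdf1 (nuF j) x - cdf1 (muF j) x)| <= dl.

Lemma joint_dist_ext (y : 'rV[\bar R]_p) :
  `|a (\row_i cdf1e (muF i) (y ord0 i)) - r * (cdfpe nuH y - cdfpe muH y)| <= dl.
Proof.
apply/ler_addgt0Pr => e e0; have rr := r0.
have e3 : 0 < e / 3 by rewrite divr_gt0.
(* Errors made by truncating distribution functions are later multiplied by [r]. *)
have e3r : 0 < e / 3 / r by rewrite divr_gt0.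
have [eta eta0 Ha] := au _ e3.
have nF : \forall k \near \oo, forall i : 'I_p,
    `|cdf1e (muF i) (y ord0 i) - cdf1 (muF i) (trunc k (y ord0 i))| <= eta.
  by apply: filter_forall => i; exact: cdf1_trunc_cvg.
near \oo => k.
have l1 : `|cdfpe nuH y - cdfp nuH (\row_i trunc k (y ord0 i))| <= e / 3 / r.
  by near: k; exact: cdfp_trunc_cvg.
have l2 : `|cdfpe muH y - cdfp muH (\row_i trunc k (y ord0 i))| <= e / 3 / r.
  by near: k; exact: cdfp_trunc_cvg.
have l0 : forall i : 'I_p,
    `|cdf1e (muF i) (y ord0 i) - cdf1 (muF i) (trunc k (y ord0 i))| <= eta by near: k.
set x : 'rV[R]_p := \row_i trunc k (y ord0 i) in l1 l2.
have l3 : `|a (\row_i cdf1e (muF i) (y ord0 i)) - a (\row_i cdf1 (muF i) (x ord0 i))| <= e / 3.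
  apply: Ha.
  - by move=> i; rewrite mxE cdf1e_itv.
  - by move=> i; rewrite mxE cdf1_ge0 cdf1_le1.
  - apply: rV_norm_le; first exact: ltW.
    by move=> i; rewrite !mxE.
have l4 := aH x.
have m1 : `|r * (cdfpe nuH y - cdfp nuH x)| <= e / 3.
  by rewrite normrM (gtr0_norm rr) mulrC -ler_pdivlMr.
have m2 : `|r * (cdfpe muH y - cdfp muH x)| <= e / 3.
  by rewrite normrM (gtr0_norm rr) mulrC -ler_pdivlMr.
move: m1 m2 l3 l4; rewrite !mulrBr !ler_norml; lra.
Unshelve. all: by end_near. Qed.

(** At either infinity both distribution functions take the same value, so the rescaled error is 0
    there; truncation transfers the bound to the end points of [0, 1]. *)
Lemma margin_bdry j : `|b j 0| <= dl /\ `|b j 1| <= dl.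
Proof.
have rr := r0.
suff H (y : \bar R) : cdf1e (nuF j) y = cdf1e (muF j) y -> `|b j (cdf1e (muF j) y)| <= dl.
  split; first by have := H -oo%E; rewrite !cdf1e_ninfty; exact.
  by have := H +oo%E; rewrite !cdf1e_pinfty; exact.
move=> E; apply/ler_addgt0Pr => e e0.
have e3 : 0 < e / 3 by rewrite divr_gt0.
have e3r : 0 < e / 3 / r by rewrite divr_gt0.
have [eta eta0 Hb] := bu j _ e3.
near \oo => k.
have l1 : `|cdf1e (nuF j) y - cdf1 (nuF j) (trunc k y)| <= e / 3 / r.
  by near: k; exact: cdf1_trunc_cvg.
have l2 : `|cdf1e (muF j) y - cdf1 (muF j) (trunc k y)| <= e / 3 / r.
  by near: k; exact: cdf1_trunc_cvg.
have l3 : `|b j (cdf1e (muF j) y) - b j (cdf1 (muF j) (trunc k y))| <= e / 3.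
  apply: Hb; rewrite ?cdf1e_itv ?cdf1_ge0 ?cdf1_le1//.
  by near: k; exact: cdf1_trunc_cvg.
have l4 := bF j (trunc k y).
have m1 : `|r * (cdf1e (nuF j) y - cdf1 (nuF j) (trunc k y))| <= e / 3.
  by rewrite normrM (gtr0_norm rr) mulrC -ler_pdivlMr.
have m2 : `|r * (cdf1e (muF j) y - cdf1 (muF j) (trunc k y))| <= e / 3.
  by rewrite normrM (gtr0_norm rr) mulrC -ler_pdivlMr.
move: m1 m2 l3 l4; rewrite E !mulrBr !ler_norml; lra.
Unshelve. all: by end_near. Qed.

Hypothesis b0 : forall j, b j 0 = 0.
Hypothesis b1 : forall j, b j 1 = 0.
Hypothesis dl0 : 0 <= dl.

Lemma margin_dist_ext j (y : \bar R) :
  `|b j (cdf1e (muF j) y) - r * (cdf1e (nuF j) y - cdf1e (muF j) y)| <= dl.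
Proof.
case: y => [x||]; first by rewrite !cdf1e_fin.
  by rewrite !cdf1e_pinfty b1 subrr mulr0 subrr normr0.
by rewrite !cdf1e_ninfty b0 subrr mulr0 subrr normr0.
Qed.

(* Taking left limits in [nuF (x) < u] for [x < qf u] replaces the jump of
   [nuF] at its quantile by the continuity of [muF] and [b]. *)
Lemma quantile_dist j u : 0 <= u <= 1 ->
  `|r * (cdf1e (muF j) (qf (nuF j) u) - u) + b j (cdf1e (muF j) (qf (nuF j) u))| <= dl.
Proof.
move=> /andP[u0 u1]; have rr := r0; have dd := dl0.
set y := qf (nuF j) u; rewrite ler_norml; apply/andP; split.
  (* The lower bound needs no left limit: the estimator is at least [u] at its own quantile. *)
  have := margin_dist_ext j y; have := ler_wpM2l (ltW rr) (cdf1e_qf_ge (nuF j) u u1).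
  by rewrite -/y ler_norml !mulrBr; lra.
have [yN|yN] := eqVneq y -oo%E.
  by have := mulr_ge0 (ltW rr) u0; rewrite yN cdf1e_ninfty b0 mulrBr mulr0; lra.
apply/ler_addgt0Pr => e e0.
have e2 : 0 < e / 2 by rewrite divr_gt0.
have e2r : 0 < e / 2 / r by rewrite divr_gt0.
have [eta eta0 Hb] := bu j _ e2.
have m0 : 0 < Num.min eta (e / 2 / r) by rewrite lt_min eta0.
have [x xy] := cdf1_left_approx (muF j) (hFcont j) y _ yN m0.
rewrite lt_min => /andP[l1 l2].
have l3 : `|b j (cdf1e (muF j) y) - b j (cdf1 (muF j) x)| <= e / 2.
  by apply: Hb; rewrite ?cdf1e_itv ?cdf1_ge0 ?cdf1_le1// ltW.
have l4 := bF j x.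
have := ler_wpM2l (ltW rr) (ltW (cdf1_lt_qf (nuF j) u x xy)).
have m1 : `|r * (cdf1e (muF j) y - cdf1 (muF j) x)| <= e / 2.
  by rewrite normrM (gtr0_norm rr) mulrC -ler_pdivlMr// ltW.
move: m1 l3 l4; rewrite !mulrBr !ler_norml; lra.
Qed.

End estimators.

Lemma finite_min_pos {R : realType} (I : finType) (Q : I -> R -> Prop) :
  (forall j e e', e' <= e -> Q j e -> Q j e') ->
  (forall j, exists2 e, 0 < e & Q j e) -> exists2 e, 0 < e & forall j, Q j e.
Proof.
move=> mono H.
have /choice [f Hf] : forall j, exists e, 0 < e /\ Q j e.
  by move=> j; have [e] := H j; exists e.
(* The starting value 1 keeps the minimum positive when [I] is empty. *)
exists (\big[Num.min/1]_j f j).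
  by apply/bigmin_gtP; split=> // j _; exact: (Hf j).1.
by move=> j; apply: mono (Hf j).2; exact: bigmin_le.
Qed.

(** * Deterministic expansion of the hybrid copula *)

Section hybrid_expansion.
Context {R : realType} {p : nat} (muH : probability (@Rp R p) R).
Context (muF : 'I_p -> probability R R) (C : 'rV[R]_p -> R).
Hypothesis hmargin : forall (j : 'I_p) (x : R),
  cdf1 (muF j) x = cdfpe muH (\row_i (if i == j then x%:E else +oo%E)).
Hypothesis hFcont : forall j, continuous (cdf1 (muF j)).
Hypothesis hC1 : forall u, cube p u -> C u = cdfpe muH (\row_i qf (muF i) (u ord0 i)).
Hypothesis hderiv : forall (j : 'I_p) u, Sj j u -> derivable C u (delta_mx 0 j).
Hypothesis hdcont : forall j : 'I_p,
  {within Sj j, continuous (fun u => 'D_(delta_mx 0 j) C u)}.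
Context (a : 'rV[R]_p -> R) (b : 'I_p -> R -> R) (B : R).
Hypothesis au : forall e : R, 0 < e -> exists2 eta : R, 0 < eta &
    forall u v, cube p u -> cube p v -> `|u - v| <= eta -> `|a u - a v| <= e.
Hypothesis bu : forall (j : 'I_p) (e : R), 0 < e -> exists2 eta : R, 0 < eta &
    forall x y, 0 <= x <= 1 -> 0 <= y <= 1 -> `|x - y| <= eta -> `|b j x - b j y| <= e.
Hypothesis b0 : forall j, b j 0 = 0.
Hypothesis b1 : forall j, b j 1 = 0.
Hypothesis bB : forall j x, 0 <= x <= 1 -> `|b j x| <= B.

Definition limit_process (u : 'rV[R]_p) : R :=
  a u - \sum_(j < p) 'D_(delta_mx 0 j) C u * b j (u ord0 j).

Let gammau j := deriv_mul_unif_continuous muH muF C hmargin hFcont hC1 hderiv hdcont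
  j (b j) (b0 j) (b1 j) (bu j).

(** With D the derivative at the mean value point c, D * r * (t - u_j) is D * (r * (t - u_j) + b c)
    minus D * b c. The first term is at most dl + e since |D| <= 1 and [b] varies little; the second
    is compared with its value at [u] at a further cost [e]. *)
Lemma copula_step j u w t r e dl eta : 0 < r -> 0 <= e -> 0 <= dl ->
  (forall x y, 0 <= x <= 1 -> 0 <= y <= 1 -> `|x - y| <= eta -> `|b j x - b j y| <= e) ->
  (forall u v, cube p u -> cube p v -> `|u - v| <= eta ->
     `|'D_(delta_mx 0 j) C u * b j (u ord0 j) -
       'D_(delta_mx 0 j) C v * b j (v ord0 j)| <= e) ->
  cube p u -> cube p w -> w ord0 j = u ord0 j -> 0 <= t <= 1 -> `|t - u ord0 j| <= eta ->
  `|u - w| <= eta ->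
  `|r * (t - u ord0 j) + b j t| <= dl ->
  `|r * (C (upd w j t) - C w) + 'D_(delta_mx 0 j) C u * b j (u ord0 j)| <= dl + 2 * e.
Proof.
move=> r0 e0 dl0 bj gj cu cw wu t01 tu uw rt.
(* Without displacement there is no intermediate point, but then [rt] itself bounds [b] at this
   coordinate by [dl]. *)
have [ut|ut] := eqVneq (u ord0 j) t.
  rewrite -ut -wu upd_id subrr mulr0 add0r wu.
  move: rt; rewrite -ut subrr mulr0 add0r => bt.
  apply: le_trans (deriv_mul_le muH muF C hmargin hFcont hC1 hderiv j (b j)
    (b0 j) (b1 j) u cu) _.
  lra.
have [c [c01 cl1 cl2 E]] := copula_mvt_dist muH muF C hmargin hFcont hC1 hderiv j w
  (u ord0 j) t cw (cu j) t01 ut.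
have wE : w = upd w j (u ord0 j) by rewrite -wu upd_id.
rewrite {2}wE E.
set x := upd w j c; have cx : cube p x by apply: cube_upd => //; lra.
have xj : x ord0 j = c by rewrite mxE eqxx.
have eta0 : 0 <= eta by apply: le_trans tu.
have ux : `|x - u| <= eta.
  apply: rV_norm_le => // i; rewrite !mxE; case: eqP => [->|_].
    exact: le_trans cl1 tu.
  rewrite distrC; apply: le_trans uw.
  by have := ler_norm_coord (u - w) i; rewrite !mxE.
have g1 := gj x u cx cu ux; rewrite xj in g1.
have b2 : `|b j c - b j t| <= e.
  apply: bj => //; first by lra.
  exact: le_trans cl2 tu.
have D1 : `|'D_(delta_mx 0 j) C x| <= 1.
  by apply: (copula_deriv_le1 muH muF C hmargin hFcont hC1 hderiv); split; rewrite ?xj.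
set D := 'D_(delta_mx 0 j) C x in g1 D1 *.
have m1 : `|D * (r * (t - u ord0 j) + b j c)| <= dl + e.
  rewrite normrM; apply: le_trans (_ : `|r * (t - u ord0 j) + b j c| <= _).
    by rewrite ler_piMl.
  move: rt b2; rewrite !ler_norml; lra.
move: m1 g1; rewrite (_ : r * (D * (t - u ord0 j)) =
  D * (r * (t - u ord0 j) + b j c) - D * b j c); last by ring.
by rewrite !ler_norml; lra.
Qed.

Lemma copula_increment u v r e dl eta : 0 < r -> 0 <= e -> 0 <= dl ->
  (forall j x y, 0 <= x <= 1 -> 0 <= y <= 1 -> `|x - y| <= eta -> `|b j x - b j y| <= e) ->
  (forall j u v, cube p u -> cube p v -> `|u - v| <= eta ->
     `|'D_(delta_mx 0 j) C u * b j (u ord0 j) -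
       'D_(delta_mx 0 j) C v * b j (v ord0 j)| <= e) ->
  cube p u -> cube p v -> `|v - u| <= eta ->
  (forall j, `|r * (v ord0 j - u ord0 j) + b j (v ord0 j)| <= dl) ->
  `|r * (C v - C u) + \sum_(j < p) 'D_(delta_mx 0 j) C u * b j (u ord0 j)|
    <= p%:R * (dl + 2 * e).
Proof.
move=> r0 e0 dl0 bj gj cu cv uv rt.
(* A path from [u] to [v] replacing coordinates in increasing order; the increment of [C] telescopes
   along it, and it stays within [eta] of [u]. *)
pose w k : 'rV[R]_p := \row_i (if (i < k)%N then v ord0 i else u ord0 i).
have eta0 : 0 <= eta by apply: le_trans uv.
have cw k : cube p (w k) by move=> i; rewrite mxE; case: ifP.
have uvj j : `|v ord0 j - u ord0 j| <= eta.
  by apply: le_trans uv; have := ler_norm_coord (v - u) j; rewrite !mxE.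
have wS (j : 'I_p) : w j.+1 = upd (w j) j (v ord0 j).
  apply/rowP => i; rewrite !mxE ltnS leq_eqVlt.
  case: eqP => [/val_inj ->|ne]; first by rewrite eqxx.
  by case: eqP => // ij; case: ne; rewrite ij.
have wj (j : 'I_p) : w j ord0 j = u ord0 j by rewrite mxE ltnn.
have uw k : `|u - w k| <= eta.
  apply: rV_norm_le => // i; rewrite !mxE; case: ifP => _; first by rewrite distrC.
  by rewrite subrr normr0.
have -> : C v - C u = \sum_(j < p) (C (upd (w j) j (v ord0 j)) - C (w j)).
  under eq_bigr do rewrite -wS.
  rewrite -(big_mkord xpredT (fun k => C (w k.+1) - C (w k))) telescope_sumr//.
  congr (C _ - C _); apply/rowP => i; rewrite mxE ?ltn_ord//.
rewrite mulr_sumr -big_split/=; apply: le_trans (ler_norm_sum _ _ _) _.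
rewrite mulr_natl -[X in _ *+ X]card_ord -sumr_const.
apply: ler_sum => j _.
by apply: (copula_step j u (w j) _ r e dl eta) => //; [exact: bj|exact: gj].
Qed.

(** The thresholds [dl] and [r1] are chosen before the estimators, which makes the estimate uniform
    over outcomes and large indices. *)
Lemma hybrid_expansion (e : R) : 0 < e -> exists2 dl : R, 0 < dl & exists r1 : R,
  forall (nuH : probability (@Rp R p) R) (nuF : 'I_p -> probability R R) (r : R),
  0 < r -> r1 <= r ->
  (forall x : 'rV[R]_p,
    `|a (\row_i cdf1 (muF i) (x ord0 i)) - r * (cdfp nuH x - cdfp muH x)| <= dl) ->
  (forall j x,
    `|b j (cdf1 (muF j) x) - r * (cdf1 (nuF j) x - cdf1 (muF j) x)| <= dl) ->
  forall u, cube p u ->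
    `|r * (hybrid_copula nuH nuF u - C u) - limit_process u| <= e /\
    `|r * (cdfpe nuH (\row_i qf (muF i) (u ord0 i)) - C u)
      - \sum_(j < p) 'D_(delta_mx 0 j) C u
          * (r * (cdf1e (nuF j) (qf (muF j) (u ord0 j)) - u ord0 j))
          * ind01 (u ord0 j) - limit_process u| <= e.
Proof.
(* Each of the [p] coordinates costs dl + 2 * dl; the variation of [a] and the joint estimator cost
   [dl] each. *)
move=> e0; pose q : R := (3 * p + 2)%:R.
have q0 : 0 < q by rewrite ltr0n addn2.
pose dl := e / q; have dl0 : 0 < dl by rewrite divr_gt0.
have dl0' := ltW dl0.
have dlq : dl * q = e by rewrite /dl divfK// gt_eqF.
have dle : p%:R * (dl + 2 * dl) + (dl + dl) = e.
  by rewrite -dlq /q natrD natrM; ring.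
have pdl : 0 <= p%:R * dl by rewrite mulr_ge0.
have [eta1 eta10 H1] := au _ dl0.
have [eta2 eta20 H2] := finite_min_pos 'I_p (fun j eta =>
    forall x y, 0 <= x <= 1 -> 0 <= y <= 1 -> `|x - y| <= eta -> `|b j x - b j y| <= dl)
  (fun j t t' tt' H x y hx hy xy => H x y hx hy (le_trans xy tt'))
  (fun j => bu j dl dl0).
have [eta3 eta30 H3] := finite_min_pos 'I_p (fun j eta =>
    forall u v, cube p u -> cube p v -> `|u - v| <= eta ->
     `|'D_(delta_mx 0 j) C u * b j (u ord0 j) -
       'D_(delta_mx 0 j) C v * b j (v ord0 j)| <= dl)
  (fun j t t' tt' H x y hx hy xy => H x y hx hy (le_trans xy tt'))
  (fun j => gammau j dl dl0).
pose eta := Num.min eta1 (Num.min eta2 eta3).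
have eta0 : 0 < eta by rewrite !lt_min eta10 eta20.
have le1 : eta <= eta1 by rewrite ge_min lexx.
have le2 : eta <= eta2 by rewrite !ge_min lexx orbT.
have le3 : eta <= eta3 by rewrite !ge_min lexx !orbT.
(* Since r * |v_j - u_j| <= B + dl, a rate beyond this threshold forces |v - u| <= eta. *)
exists dl => //; exists ((B + dl) / eta) => nuH nuF r r0 r1 aH bF u cu.
have aHe := joint_dist_ext muH muF a au nuH r dl r0 aH.
have bFe := margin_dist_ext muF b nuF r dl bF b0 b1 dl0'.
split.
  (* As C(v) = H(y), the hybrid error splits into the rescaled error of the joint estimator at [y]
     and r * (C v - C u). *)
  pose y := \row_i qf (nuF i) (u ord0 i).
  pose v := \row_i cdf1e (muF i) (y ord0 i).
  have cv : cube p v by exact: cube_cdf1e.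
  have Cv : C v = cdfpe muH y := copula_cdf muH muF C hmargin hFcont hC1 y.
  have qd j : `|r * (v ord0 j - u ord0 j) + b j (v ord0 j)| <= dl.
    rewrite !mxE; exact: (quantile_dist muF hFcont b bu nuF r dl r0 bF b0 b1 dl0' j _ (cu j)).
  have uv : `|v - u| <= eta.
    apply: rV_norm_le; first exact: ltW.
    move=> j; rewrite !mxE.
    have : r * `|v ord0 j - u ord0 j| <= B + dl.
      rewrite -{1}(gtr0_norm r0) -normrM.
      have := bB j _ (cv j); have := qd j; rewrite !ler_norml; lra.
    rewrite !mxE mulrC -ler_pdivlMr// => /le_trans; apply.
    by rewrite ler_pdivrMr// mulrC -ler_pdivrMr.
  have inc := copula_increment u v r dl dl eta r0 dl0' dl0'
    (fun j x y hx hy xy => H2 j x y hx hy (le_trans xy le2))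
    (fun j x y hx hy xy => H3 j x y hx hy (le_trans xy le3)) cu cv uv qd.
  have av : `|a v - a u| <= dl by apply: H1 => //; exact: le_trans uv le1.
  have := aHe y; rewrite -/v -Cv.
  change (hybrid_copula nuH nuF u) with (cdfpe nuH y).
  rewrite /limit_process; move: inc av; rewrite -dle !mulrBr.
  move: (p%:R * (dl + 2 * dl)) (\sum_(j < p) _) => S T.
  by rewrite !ler_norml; lra.
pose y := \row_i qf (muF i) (u ord0 i).
have yu : \row_i cdf1e (muF i) (y ord0 i) = u.
  by apply/rowP => i; rewrite !mxE cdf1e_qf.
have := aHe y; rewrite yu -hC1//.
rewrite -/y /limit_process; set S := \sum_(j < p) _; set T := \sum_(j < p) _.
(* On a face both terms vanish, one by the indicator and one by the boundary value of [b]; elsewhere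
   the derivative is at most 1 in absolute value. *)
have ST : `|T - S| <= p%:R * dl.
  rewrite -sumrB; apply: le_trans (ler_norm_sum _ _ _) _.
  rewrite mulr_natl -[X in _ *+ X]card_ord -sumr_const; apply: ler_sum => j _.
  have := bFe j (qf (muF j) (u ord0 j)); rewrite cdf1e_qf// /ind01.
  case: ifPn => [uj|nuj].
    have D1 : `|'D_(delta_mx 0 j) C u| <= 1.
      by apply: (copula_deriv_le1 muH muF C hmargin hFcont hC1 hderiv); split.
    rewrite mulr1 -mulrBr normrM => h; apply: le_trans h; by rewrite ler_piMl.
  move=> _; have [|->|->] := itv_bdry _ (cu j); first by rewrite (negbTE nuj).
    by rewrite b0 !mulr0 subrr normr0.
  by rewrite b1 !mulr0 subrr normr0.
have : p%:R * (dl + 2 * dl) = p%:R * dl + 2 * (p%:R * dl) by ring.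
move: ST pdl; rewrite -dle; move: (p%:R * (dl + 2 * dl)) (p%:R * dl) => X Y.
by rewrite !ler_norml; lra.
Qed.

End hybrid_expansion.

(** * Supremum distances and the product metric *)

Section supdist_theory.
Context {R : realType} {T : Type} (A : set T).
Implicit Types f g h : T -> R.

Lemma supdist_le f g (e : \bar R) :
  (forall t, A t -> ((`|f t - g t|)%:E <= e)%E) -> (supdist A f g <= e)%E.
Proof. by move=> H; apply: ge_ereal_sup => _ [t At <-]; exact: H. Qed.

Lemma supdist_ge f g t : A t -> ((`|f t - g t|)%:E <= supdist A f g)%E.
Proof. by move=> At; apply: ereal_sup_ubound; exists t. Qed.

Lemma supdistC f g : supdist A f g = supdist A g f.
Proof.
by rewrite /supdist; congr ereal_sup; apply: eq_imagel => t _; rewrite distrC.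
Qed.

Lemma supdist_triangle f g h :
  (supdist A f h <= supdist A f g + supdist A g h)%E.
Proof.
apply: supdist_le => t At.
apply: le_trans (_ : ((`|f t - g t|)%:E + (`|g t - h t|)%:E <= _)%E).
  by rewrite -EFinD lee_fin ler_distD.
by apply: leeD; exact: supdist_ge.
Qed.

(** Over an empty set the supremum would be -oo. *)
Lemma supdist_ge0 f g : A !=set0 -> (0 <= supdist A f g)%E.
Proof. by move=> [t At]; apply: le_trans (supdist_ge f g t At); rewrite lee_fin. Qed.

Lemma supdistxx f : A !=set0 -> supdist A f f = 0%E.
Proof.
move=> A0; apply/eqP; rewrite eq_le supdist_ge0// andbT.
by apply: supdist_le => t At; rewrite subrr normr0.
Qed.

Lemma supdist_bnd_lty f g : bnd A f -> bnd A g -> (supdist A f g < +oo)%E.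
Proof.
move=> [m fm] [n gn]; apply: (@le_lt_trans _ _ (m + n)%:E); last exact: ltry.
apply: supdist_le => t At; rewrite lee_fin; apply: le_trans (ler_normB _ _) _.
by rewrite lerD ?fm ?gn.
Qed.

End supdist_theory.

Section prod_dist_theory.
Context {R : realType} {p : nat}.
Implicit Types F G H : ('rV[R]_p -> R) * ('I_p -> R -> R).

Lemma prod_dist_le F G (e : \bar R) : (0 <= e)%E ->
  (supdist setT F.1 G.1 <= e)%E -> (forall j, supdist setT (F.2 j) (G.2 j) <= e)%E ->
  (prod_dist p F G <= e)%E.
Proof.
move=> e0 h1 h2; rewrite /prod_dist ge_max h1/=.
by apply/bigmax_leP; split.
Qed.

Lemma prod_dist_ge1 F G : (supdist setT F.1 G.1 <= prod_dist p F G)%E.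
Proof. by rewrite /prod_dist le_max lexx. Qed.

Lemma prod_dist_ge2 F G j : (supdist setT (F.2 j) (G.2 j) <= prod_dist p F G)%E.
Proof.
rewrite /prod_dist le_max; apply/orP; right.
exact: (le_bigmax _ (fun j => supdist setT (F.2 j) (G.2 j))).
Qed.

Lemma prod_dist_metric : metric_on (@prod_inS R p) (@prod_dist R p).
Proof.
have V0 : [set: 'rV[R]_p] !=set0 by exists 0.
have R0 : [set: R] !=set0 by exists 0.
have ge0 F G : (0 <= prod_dist p F G)%E.
  by apply: le_trans (prod_dist_ge1 F G); exact: supdist_ge0.
split=> //.
- move=> F; apply/eqP; rewrite eq_le ge0 andbT.
  by apply: prod_dist_le => [//||j]; rewrite supdistxx.
- move=> F G; rewrite /prod_dist supdistC; congr maxe.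
  by apply: eq_bigr => j _; rewrite supdistC.
- move=> F G H; apply: prod_dist_le; first exact: adde_ge0.
    apply: le_trans (supdist_triangle _ _ G.1 _) _.
    by apply: leeD; exact: prod_dist_ge1.
  move=> j; apply: le_trans (supdist_triangle _ _ (G.2 j) _) _.
  by apply: leeD; exact: prod_dist_ge2.
- move=> F G [F1 F2] [G1 G2]; rewrite ge0_fin_numE// /prod_dist gt_max.
  rewrite supdist_bnd_lty//=; apply/bigmax_ltP; split=> // j _.
  exact: supdist_bnd_lty.
Qed.

Lemma prod_dist_lt F G (e : R) : (prod_dist p F G < e%:E)%E ->
  (forall x, `|F.1 x - G.1 x| <= e) /\ (forall j x, `|F.2 j x - G.2 j x| <= e).
Proof.
move=> lt; split=> [x|j x]; rewrite -lee_fin; apply: le_trans (ltW lt).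
  by apply: le_trans (prod_dist_ge1 F G); exact: (supdist_ge setT).
by apply: le_trans (prod_dist_ge2 F G j); exact: (supdist_ge setT).
Qed.

End prod_dist_theory.

Theorem theorem2p3 (R : realType) (p : nat)
  (muH : probability (Rp p) R) (muF : 'I_p -> probability R R)
  (C : 'rV[R]_p -> R)
  (* F_j is the j-th margin of H, and is continuous *)
  (hmargin : forall (j : 'I_p) (x : R),
     cdf1 (muF j) x = cdfpe muH (\row_i (if i == j then x%:E else +oo%E)))
  (hFcont : forall j, continuous (cdf1 (muF j)))
  (* C is the copula of H *)
  (hC1 : forall u, cube p u -> C u = cdfpe muH (\row_i qf (muF i) (u ord0 i)))
  (hC2 : forall x, cdfp muH x = C (\row_i cdf1 (muF i) (x ord0 i)))
  (* partial derivatives exist and are continuous on {u in [0,1]^p : 0 < u_j < 1} *)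
  (hderiv : forall (j : 'I_p) u, Sj j u -> derivable C u (delta_mx 0 j))
  (hdcont : forall j : 'I_p,
     {within Sj j, continuous (fun u => 'D_(delta_mx 0 j) C u)})
  (* estimators *)
  (d : measure_display) (Om : nat -> measurableType d)
  (P : forall n, probability (Om n) R)
  (Hhat : forall n, Om n -> probability (Rp p) R)
  (Fhat : forall n, Om n -> 'I_p -> probability R R)
  (r : nat -> R) (hr0 : forall n, 0 < r n) (hrinf : r @ \oo --> +oo)
  (* limit processes *)
  (d0 : measure_display) (Om0 : measurableType d0) (P0 : probability Om0 R)
  (alpha : Om0 -> 'rV[R]_p -> R) (beta : Om0 -> 'I_p -> R -> R)
  (halpha : random_elt P0 (bnd (cube p)) (supdist (cube p)) alpha)
  (hbeta : forall j, random_elt P0 (bnd `[0, 1]) (supdist `[0, 1])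
                                (fun w => beta w j))
  (hacont : {ae P0, forall w, continuous
     (fun y : 'rV[\bar R]_p => alpha w (\row_i cdf1e (muF i) (y ord0 i)))})
  (hbcont : {ae P0, forall w, forall j, continuous
     (fun y : \bar R => beta w j (cdf1e (muF j) y))})
  (hweak : weak_conv (@prod_inS R p) (@prod_dist R p) P
     (fun n w => ((fun x : 'rV[R]_p => r n * (cdfp (Hhat n w) x - cdfp muH x)),
                  (fun j x => r n * (cdf1 (Fhat n w j) x - cdf1 (muF j) x))))
     P0
     (fun w => ((fun x : 'rV[R]_p => alpha w (\row_i cdf1 (muF i) (x ord0 i))),
                (fun j x => beta w j (cdf1 (muF j) x))))) :
  (* asymptotic expansion, remainder o_p(1) uniformly in u *)
  (forall eps : R, 0 < eps ->
     (fun n => outer_prob (P n)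
        [set w | (eps%:E < ereal_sup [set (`|
            r n * (hybrid_copula (Hhat n w) (Fhat n w) u - C u)
            - (r n * (cdfpe (Hhat n w) (\row_i qf (muF i) (u ord0 i)) - C u)
               - \sum_(j < p) 'D_(delta_mx 0 j) C u
                   * (r n * (cdf1e (Fhat n w j) (qf (muF j) (u ord0 j)) - u ord0 j))
                   * ind01 (u ord0 j)) |)%:E | u in cube p])%E])
     @ \oo --> 0%E)
  (* weak convergence of the hybrid copula process in l^oo([0,1]^p) *)
  /\ weak_conv (bnd (cube p)) (supdist (cube p)) P
       (fun n w u => r n * (hybrid_copula (Hhat n w) (Fhat n w) u - C u))
       P0
       (fun w u => alpha w u
                   - \sum_(j < p) 'D_(delta_mx 0 j) C u * beta w j (u ord0 j))
  (* continuity of trajectories and boundary values *)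
  /\ {ae P0, forall w, {within cube p, continuous (alpha w)} /\
        forall j, {within `[0, 1], continuous (beta w j)}
                  /\ beta w j 0 = 0 /\ beta w j 1 = 0}.
Proof.
pose X0 w : ('rV[R]_p -> R) * ('I_p -> R -> R) :=
  ((fun x : 'rV[R]_p => alpha w (\row_i cdf1 (muF i) (x ord0 i))),
   (fun j x => beta w j (cdf1 (muF j) x))).
pose X n w : ('rV[R]_p -> R) * ('I_p -> R -> R) :=
  ((fun x : 'rV[R]_p => r n * (cdfp (Hhat n w) x - cdfp muH x)),
   (fun j x => r n * (cdf1 (Fhat n w j) x - cdf1 (muF j) x))).
pose Y w := limit_process C (alpha w) (beta w).
have md := @prod_dist_metric R p.
have bnd_diff (s x y : R) : 0 < s -> 0 <= x <= 1 -> 0 <= y <= 1 -> `|s * (x - y)| <= s.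
  move=> s0 x01 y01; rewrite normrM (gtr0_norm s0) ler_piMr ?(ltW s0)//.
  by rewrite ler_norml; lra.
have XS n w : prod_inS p (X n w).
  split=> [|j]; exists (r n) => x _; apply: bnd_diff => //; rewrite ?cdfp_itv//.
    by rewrite cdf1_ge0 cdf1_le1.
  by rewrite cdf1_ge0 cdf1_le1.
(* Later arguments fix an outcome in [G]. Moduli are recorded on the cube itself, whereas the
   hypotheses give continuity only after composition with the margins. *)
pose G := [set w | [/\ bnd (cube p) (alpha w) /\ forall j, bnd `[0, 1] (beta w j),
  forall e : R, 0 < e -> exists2 eta : R, 0 < eta &
    forall u v, cube p u -> cube p v -> `|u - v| <= eta -> `|alpha w u - alpha w v| <= e,
  forall (j : 'I_p) (e : R), 0 < e -> exists2 eta : R, 0 < eta &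
    forall x y, 0 <= x <= 1 -> 0 <= y <= 1 -> `|x - y| <= eta ->
      `|beta w j x - beta w j y| <= e,
  forall j, beta w j 0 = 0 &
  forall j, beta w j 1 = 0]].
have aeG : {ae P0, forall w, G w}.
  have supp := weak_conv_support _ _ _ _ _ _ md XS hweak.
  have aeb : {ae P0, forall w, forall j, bnd `[0, 1] (beta w j)}.
    by apply: filter_forall => j; have [] := hbeta j.
  have [aea _] := halpha.
  have aebd : {ae P0, forall w, bnd (cube p) (alpha w) /\
    forall j, bnd `[0, 1] (beta w j)} by apply: filterS2 aea aeb.
  apply: filterS3 (filterI supp aebd) hacont hbcont => w [sw [aw bw]] acw bcw.
  have au := quotient_cube_unif_continuous muF (alpha w) hFcont acw.
  have bu j := quotient_itv_unif_continuous (muF j) (beta w j) (hFcont j) (bcw j).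
  (* Some value of an [X n] is within [e] of the limit, and its marginal error vanishes at
     infinity. *)
  have bd j : forall e : R, 0 < e -> `|beta w j 0| <= e /\ `|beta w j 1| <= e.
    move=> e e0; have [n [v [_ lt]]] := sw 0%N e e0.
    have [_ l2] := prod_dist_lt _ _ _ lt.
    exact: (margin_bdry muF (beta w) bu (Fhat n v) (r n) e (hr0 n) l2 j).
  split=> // j; apply/eqP; rewrite -normr_le0; apply/ler_addgt0Pr => e e0;
    by rewrite add0r; have [] := bd j e e0.
have bound w : G w -> exists B, forall j x, 0 <= x <= 1 -> `|beta w j x| <= B.
  move=> [[_ bb] _ _ _ _].
  have /choice [M HM] := bb.
  exists (\sum_j `|M j|) => j x x01.
  apply: le_trans (HM j x _) _; first by rewrite /= in_itv.
  apply: le_trans (ler_norm _) _; rewrite (bigD1 j)//= lerDl.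
  by apply: sumr_ge0.
(* Both sides of the expansion are compared with the same [Y w0]: the first bound serves the weak
   convergence, and the two together the remainder. *)
have expn w0 : G w0 -> forall e : R, 0 < e -> exists2 dl : R, 0 < dl & exists N,
    forall n w, (N <= n)%N -> (prod_dist p (X0 w0) (X n w) < dl%:E)%E ->
    forall u, cube p u ->
      `|r n * (hybrid_copula (Hhat n w) (Fhat n w) u - C u) - Y w0 u| <= e /\
      `|r n * (cdfpe (Hhat n w) (\row_i qf (muF i) (u ord0 i)) - C u)
        - \sum_(j < p) 'D_(delta_mx 0 j) C u
            * (r n * (cdf1e (Fhat n w j) (qf (muF j) (u ord0 j)) - u ord0 j))
            * ind01 (u ord0 j) - Y w0 u| <= e.
  move=> Gw e e0; have [B HB] := bound w0 Gw; have [_ au bu b0 b1] := Gw.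
  have [dl dl0 [r1 H]] := hybrid_expansion muH muF C hmargin hFcont hC1 hderiv hdcont
    (alpha w0) (beta w0) B au bu b0 b1 HB e e0.
  have /cvgryPge /(_ r1) [N _ HN] := hrinf.
  exists dl => //; exists N => n w Nn lt.
  have [l1 l2] := prod_dist_lt _ _ _ lt.
  exact: (H (Hhat n w) (Fhat n w) (r n) (hr0 n) (HN n Nn) l1 l2).
split; last split.
- move=> eps eps0.
  pose A n := [set w : Om n | (eps%:E < ereal_sup [set (`|
      r n * (hybrid_copula (Hhat n w) (Fhat n w) u - C u)
      - (r n * (cdfpe (Hhat n w) (\row_i qf (muF i) (u ord0 i)) - C u)
         - \sum_(j < p) 'D_(delta_mx 0 j) C u
             * (r n * (cdf1e (Fhat n w j) (qf (muF j) (u ord0 j)) - u ord0 j))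
             * ind01 (u ord0 j)) |)%:E | u in cube p])%E].
  change (outer_prob (P n) (A n) @[n --> \oo] --> 0%E).
  have eps2 : 0 < eps / 2 by rewrite divr_gt0.
  have lim e : 0 < e -> \forall n \near \oo, (outer_prob (P n) (A n) < e%:E)%E.
    move=> e0.
    (* The limit functional is 0 because, near a good value of the limit, both sides are within eps
       / 2 of it and the event [A n] cannot occur. *)
    have [||||N _ HN] :=
      weak_conv_limsup _ _ _ X _ _ md XS hweak (fun n => \1_(A n)) (fun=> 0) 1 _ _ _ _ e e0.
    + by move=> n w; rewrite indicE; case: (_ \in _); rewrite ?normr1 ?normr0.
    + exact: measurable_cst.
    + by move=> w; rewrite normr0.
    + apply: filterS aeG => w0 Gw0 e' e'0; have [dl dl0 [N HN]] := expn w0 Gw0 _ eps2.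
      exists dl => //; exists N => n w Nn lt.
      rewrite indicE memNset ?add0r ?ltW//= /A/=; apply/negP; rewrite -leNgt.
      apply: ge_ereal_sup => _ [u cu <-]; rewrite lee_fin.
      have [] := HN n w Nn lt u cu; rewrite !ler_norml; lra.
    + exists N => // n Nn; have := HN n Nn.
      rewrite /= integral0 add0e; apply: le_lt_trans; exact: outer_prob_le_expect.
  have fin : \forall n \near \oo, outer_prob (P n) (A n) \is a fin_num.
    apply: filterS (lim 1 ltr01) => n lt.
    by rewrite ge0_fin_numE ?outer_prob_ge0// (lt_trans lt)// ltry.
  apply: cvg_EFin => //; apply/cvgrPdist_lt => e e0.
  apply: filterS2 fin (lim e e0) => n fn; rewrite -{1}(fineK fn) lte_fin /= => lt.
  by rewrite sub0r normrN ger0_norm// fine_ge0// outer_prob_ge0.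
- have Yle w u : G w -> cube p u ->
      forall B, (forall j x, 0 <= x <= 1 -> `|beta w j x| <= B) ->
      `|\sum_(j < p) 'D_(delta_mx 0 j) C u * beta w j (u ord0 j)| <= p%:R * B.
    move=> [_ _ _ b0 b1] cu B HB; apply: le_trans (ler_norm_sum _ _ _) _.
    rewrite mulr_natl -[X in _ *+ X]card_ord -sumr_const; apply: ler_sum => j _.
    apply: le_trans (HB j _ (cu j)).
    exact: (deriv_mul_le muH muF C hmargin hFcont hC1 hderiv j (beta w j)).
  have bndY w : G w -> bnd (cube p) (Y w).
    move=> Gw; have [B HB] := bound w Gw; have [[[M HM] _] _ _ _ _] := Gw.
    exists (M + p%:R * B) => u cu; apply: le_trans (ler_normB _ _) _.
    by rewrite lerD ?HM ?Yle.
  apply: (weak_conv_local _ _ _ X _ X0 md XS hweak).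
  + move=> n w; exists (r n) => u cu; apply: bnd_diff => //; first exact: cdfpe_itv.
    by rewrite hC1//; exact: cdfpe_itv.
  + apply: (random_elt_local _ _ _ X _ X0 md hweak _ _ _ _ G) => //.
      by apply: filterS aeG => w; exact: bndY.
    move=> w0 Gw0 e e0.
    have q0 : 0 < (p.+2%:R : R) by [].
    (* One share for alpha, one for each of the [p] products, and one spare for strictness. *)
    have dl0 : 0 < e / p.+2%:R by rewrite divr_gt0.
    exists (e / p.+2%:R) => // w Gw lt; set dl := e / p.+2%:R in dl0 lt.
    have dle : dl + p%:R * dl + dl = e.
      have : dl * p.+2%:R = e by rewrite divfK.
      by move=> <-; rewrite -addn2 natrD; ring.
    have [l1 l2] := prod_dist_lt _ _ _ lt.
    have [_ au bu b0 b1] := Gw; have [_ au0 bu0 b00 b10] := Gw0.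
    apply: (@le_lt_trans _ _ (dl + p%:R * dl)%:E); last by rewrite lte_fin; lra.
    apply: supdist_le => u cu; rewrite lee_fin.
    (* [l1] compares trajectories only at images of real points. Taking both joint laws equal to
       [muH], with rate 1, turns [joint_dist_ext] into an extension of that bound to the whole
       cube. *)
    have da : `|alpha w0 u - alpha w u| <= dl.
      have := joint_dist_ext muH muF (fun v => alpha w0 v - alpha w v) _ muH 1 dl ltr01.
      move=> /(_ _ _ (\row_i qf (muF i) (u ord0 i))).
      rewrite subrr mulr0 subr0 (_ : \row_i _ = u); last first.
        by apply/rowP => i; rewrite !mxE cdf1e_qf.
      apply=> [eps eps0|x]; last by rewrite subrr mulr0 subr0; exact: l1.
      have eps2 : 0 < eps / 2 by rewrite divr_gt0.
      have [t1 t10 h1] := au _ eps2; have [t2 t20 h2] := au0 _ eps2.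
      exists (Num.min t1 t2) => [|v v' cv cv']; first by rewrite lt_min t10.
      rewrite le_min => /andP[v1 v2].
      have := h1 v v' cv cv' v1; have := h2 v v' cv cv' v2; rewrite !ler_norml; lra.
    have db j x : 0 <= x <= 1 -> `|beta w0 j x - beta w j x| <= dl.
      move=> x01.
      have := margin_dist_ext muF (fun j v => beta w0 j v - beta w j v) muF 1 dl _ _ _ (ltW dl0) j.
      move=> /(_ _ _ _ (qf (muF j) x)); rewrite subrr mulr0 subr0 cdf1e_qf//; apply.
      * by move=> i v; rewrite subrr mulr0 subr0; exact: l2.
      * by move=> i; rewrite b0 b00 subr0.
      * by move=> i; rewrite b1 b10 subr0.
    rewrite (_ : Y w0 u - _ = (alpha w0 u - alpha w u) - \sum_(j < p)
       'D_(delta_mx 0 j) C u * (beta w0 j (u ord0 j) - beta w j (u ord0 j))); last first.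
      under [in RHS]eq_bigr do rewrite mulrBr.
      by rewrite sumrB /Y /limit_process; ring.
    apply: le_trans (ler_normB _ _) _; rewrite lerD//.
    apply: le_trans (ler_norm_sum _ _ _) _.
    rewrite mulr_natl -[X in _ *+ X]card_ord -sumr_const; apply: ler_sum => j _.
    apply: le_trans (db j _ (cu j)).
    apply: (deriv_mul_le muH muF C hmargin hFcont hC1 hderiv j
      (fun x => beta w0 j x - beta w j x)) => //.
      by rewrite b0 b00 subr0.
    by rewrite b1 b10 subr0.
  + apply: filterS aeG => w0 Gw0 e e0.
    have e2 : 0 < e / 2 by rewrite divr_gt0.
    have [dl dl0 [N HN]] := expn w0 Gw0 _ e2; exists dl => //; exists N => n w Nn lt.
    apply: (@le_lt_trans _ _ (e / 2)%:E); last by rewrite lte_fin; lra.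
    apply: supdist_le => u cu; rewrite lee_fin distrC.
    by have [] := HN n w Nn lt u cu.
- apply: filterS aeG => w [_ au bu b0 b1]; split.
    exact: unif_continuous_within.
  move=> j; split=> //; apply: unif_continuous_within => e e0.
  by have [eta eta0 H] := bu j e e0; exists eta.
Qed.
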